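(* For any nonabelian finitely generated free group $\Gamma$, there are a null (hence tame) minimal action $\Gamma\curvearrowright \tilde{X}$, an effective strongly proximal action $\Gamma\curvearrowright Y$, and a point-distal non-open extension $\tilde{X}\rightarrow Y$ with a unique RIM.
   Context: All actions are continuous actions of a countably infinite discrete group $\Gamma$ on compact metrizable spaces. For a compact metrizable space $X$, $\mathcal{M}(X)$ denotes the space of Borel probability measures on $X$ with the weak$^*$-topology. An action $\Gamma\curvearrowright X$ is minimal if there is no proper nonempty closed $\Gamma$-invariant subset; it is strongly proximal if for the induced action on $\mathcal{M}(X)$ every nonempty closed $\Gamma$-invariant subset intersects $X$ (viewed as point masses); it is effective if for any distinct $s,t\in\Gamma$ one has $sy\neq ty$ for some $y$. For a sequence $\mathfrak{s}=\{s_n\}$ in $\Gamma$ and a finite open cover $\mathcal{U}$, the sequence entropy is $\limsup_n \frac1n\log N(\bigvee_{i=1}^n s_i^{-1}\mathcal{U})$; the action is null if this is $0$ for all $\mathfrak{s},\mathcal{U}$. Tame means the induced action on $C(X)$ contains no isomorphic dynamical copy of $\ell^1(\Gamma)$; null actions are tame. An extension (factor map) $\pi:X\to Y$ is a $\Gamma$-equivariant continuous surjection. A RIM (relative invariant measure) for $\pi$ is a continuous $\Gamma$-equivariant map $Y\to\mathcal{M}(X)$ such that the image of each $y$ has support in $\pi^{-1}(y)$. $\pi$ is point-distal if there is a point $x\in X$ with dense orbit such that for any $x'\neq x$ with $\pi(x)=\pi(x')$ the orbit closure of $(x,x')$ does not meet the diagonal. *)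

(* Defs.v *)
From HB Require Import structures.
From mathcomp Require Import all_boot all_order all_algebra.
From mathcomp Require Import all_classical all_reals all_analysis.

Set Implicit Arguments.
Unset Strict Implicit.
Unset Printing Implicit Defensive.

Import Order.TTheory GRing.Theory Num.Theory.
Import numFieldNormedType.Exports.
Local Open Scope classical_set_scope.
Local Open Scope ring_scope.

Record group := Group {
  gcar :> Type;
  gmul : gcar -> gcar -> gcar;
  gone : gcar;
  ginv : gcar -> gcar;
  gmulA : forall x y z, gmul x (gmul y z) = gmul (gmul x y) z;
  gmul1g : forall x, gmul gone x = x;
  gmulVg : forall x, gmul (ginv x) x = gone }.

Definition group_hom (G H : group) (h : G -> H) :=
  forall x y, h (gmul x y) = gmul (h x) (h y).

Definition free_basis (G : group) (n : nat) (e : 'I_n -> G) :=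
  forall (H : group) (f : 'I_n -> H),
    exists! h : G -> H, group_hom h /\ forall i, h (e i) = f i.

Definition cm_space (R : realType) (X : pseudoPMetricType R) :=
  hausdorff_space X /\ compact [set: X].

Definition is_action (G : group) (X : ptopologicalType) (a : G -> X -> X) :=
  [/\ forall g, continuous (a g),
      forall x, a (gone G) x = x &
      forall g h x, a (gmul g h) x = a g (a h x)].

Definition invariant (G : group) (X : Type) (a : G -> X -> X) (A : set X) :=
  forall g, a g @` A `<=` A.

Definition minimal_action (G : group) (X : ptopologicalType) (a : G -> X -> X) :=
  forall A : set X, closed A -> A !=set0 -> invariant a A -> A = [set: X].

Definition effective_action (G : group) (X : Type) (a : G -> X -> X) :=
  forall s t : G, s <> t -> exists y, a s y <> a t y.

Definition borel (X : ptopologicalType) := g_sigma_algebraType (@open X).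

Definition prob (R : realType) (X : ptopologicalType) := probability (borel X) R.

Definition mint (R : realType) (X : ptopologicalType) (mu : prob R X)
  (f : X -> R) : R := Rintegral mu [set: borel X] f.

(* C is weak-* closed in M(X): every mu outside C has a basic weak-*
   neighbourhood  {nu | |int f_i dnu - int f_i dmu| < e, i < k}  missing C *)
Definition wstar_closed (R : realType) (X : ptopologicalType) (C : set (prob R X)) :=
  forall mu, ~ C mu ->
    exists (k : nat) (f : 'I_k -> X -> R) (e : R),
      0 < e /\ (forall i, continuous (f i)) /\
      forall nu, C nu -> ~ (forall i, `| mint nu (f i) - mint mu (f i) | < e).

Definition is_push (R : realType) (G : group) (X : ptopologicalType)
  (a : G -> X -> X) (g : G) (mu nu : prob R X) :=
  forall A : set (borel X), measurable A -> nu A = mu (a g @^-1` A).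

Definition is_dirac (R : realType) (X : ptopologicalType) (nu : prob R X) (x : X) :=
  forall A : set (borel X), measurable A -> nu A = (\1_A x)%:E.

Definition prob_invariant (R : realType) (G : group) (X : ptopologicalType)
  (a : G -> X -> X) (C : set (prob R X)) :=
  forall g mu, C mu -> exists2 nu, C nu & is_push a g mu nu.

Definition strongly_proximal (R : realType) (G : group) (X : ptopologicalType)
  (a : G -> X -> X) :=
  forall C : set (prob R X), wstar_closed C -> C !=set0 ->
    prob_invariant a C -> exists nu x, C nu /\ is_dirac nu x.

Definition msupport (R : realType) (X : ptopologicalType) (mu : prob R X) : set X :=
  [set x | forall U : set X, open U -> U x -> (0 < mu U)%E].

Definition covers_with (X : Type) (I : Type) (V : I -> set X) (k : nat) : bool :=
  `[< exists J : 'I_k -> I, forall x, exists i, V (J i) x >].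

Definition covnum (X : Type) (I : Type) (V : I -> set X) : nat :=
  match pselect (exists k, covers_with V k) with
  | left h => ex_minn h
  | right _ => 0%N
  end.

(* the join  \/_{i=1}^n s_i^{-1} U  of the cover U : 'I_m -> set X *)
Definition join_cover (G : group) (X : Type) (a : G -> X -> X) (s : nat -> G)
  (m : nat) (U : 'I_m -> set X) (n : nat) : ('I_n -> 'I_m) -> set X :=
  fun j => [set x | forall i : 'I_n, U (j i) (a (s i.+1) x)].

Definition seq_entropy (R : realType) (G : group) (X : Type) (a : G -> X -> X)
  (s : nat -> G) (m : nat) (U : 'I_m -> set X) : \bar R :=
  limn_esup (fun n : nat =>
    (ln ((covnum (@join_cover G X a s m U n))%:R : R) / (n%:R : R))%:E).

Definition null_action (R : realType) (G : group) (X : ptopologicalType)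
  (a : G -> X -> X) :=
  forall (s : nat -> G) (m : nat) (U : 'I_m -> set X),
    (forall i, open (U i)) -> \bigcup_i U i = [set: X] ->
    seq_entropy R a s U = 0%E.

Definition factor_map (G : group) (X Y : ptopologicalType)
  (aX : G -> X -> X) (aY : G -> Y -> Y) (pi : X -> Y) :=
  [/\ continuous pi, forall y, exists x, pi x = y &
      forall g x, pi (aX g x) = aY g (pi x)].

Definition open_map (X Y : ptopologicalType) (pi : X -> Y) :=
  forall A : set X, open A -> open (pi @` A).

Definition point_distal (G : group) (X Y : ptopologicalType)
  (aX : G -> X -> X) (pi : X -> Y) :=
  exists x : X,
    closure (range (fun g : G => aX g x)) = [set: X] /\
    forall x', x' <> x -> pi x' = pi x ->
      ~ exists z : X, closure (range (fun g : G => (aX g x, aX g x'))) (z, z).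

Definition is_RIM (R : realType) (G : group) (X Y : ptopologicalType)
  (aX : G -> X -> X) (aY : G -> Y -> Y) (pi : X -> Y) (rho : Y -> prob R X) :=
  [/\ forall f : X -> R, continuous f -> continuous (fun y => mint (rho y) f),
      forall g y, is_push aX g (rho y) (rho (aY g y)) &
      forall y, msupport (rho y) `<=` pi @^-1` [set y]].

Definition unique_RIM (R : realType) (G : group) (X Y : ptopologicalType)
  (aX : G -> X -> X) (aY : G -> Y -> Y) (pi : X -> Y) :=
  exists rho : Y -> prob R X, is_RIM aX aY pi rho /\
    forall rho' : Y -> prob R X, is_RIM aX aY pi rho' ->
      forall y (A : set (borel X)), measurable A -> rho' y A = rho y A.

(* Main.v *)
Require Import Defs.
From HB Require Import structures.
From mathcomp Require Import all_boot all_order all_algebra.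
From mathcomp Require Import all_classical all_reals all_analysis.
From mathcomp Require Import measurable_realfun zify ring lra.

(** Let Y be the boundary of the free group (infinite reduced words), K the
    dyadic odometer on which every basis element acts by adding one, and
    X' = Y * K.  The point o = (a^oo, 0) has trivial stabilizer; X is obtained
    from X' by doubling the points of its orbit, where the two copies of o are
    separated by the set E of the points (a^(2^j) b ..., k) with k divisible by
    2^j.  Near the copy of o in the closure of E, only the rays a^(2^j) b ...
    and a^oo occur, so X -> Y is not open.  Each fiber of X' meets the doubled
    orbit in a Haar-null set, so Haar measure on the fibers lifts to a RIM.  It
    is the only one: over b^oo nothing is doubled and b acts as the odometer,
    which is uniquely ergodic, and the orbit of b^oo is dense.

    Nullness is a polynomial bound on the number of atoms of joins.  Translates
    of one-letter cylinders of Y never cross, and N pairwise non-crossing sets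
    cut out at most N + 1 atoms; two distinct translates of E overlap only over
    one level a^(2^j) b of one of them, because differences of distinct powers
    of two determine the powers. *)

Set Implicit Arguments.
Unset Strict Implicit.
Unset Printing Implicit Defensive.

Import Order.TTheory GRing.Theory Num.Theory.
Import numFieldNormedType.Exports.
Local Open Scope classical_set_scope.

(** * Groups and permutation actions *)

(** The stabilizer of a^oo in the boundary is the infinite group of powers of a, so splitting a^oo
    alone could not be carried coherently along its orbit. The odometer removes these stabilizers,
    and since it acts by isometries it adds no proximal pairs to the fibers. The shape of E answers
    three demands. Its boundary in X' must be the single point o, so that each translate splits one
    point only; divisibility of k by 2^j ensures this, because (a^oo, k) with k nonzero is then not
    a limit of E. The same condition makes the trace of E on a fiber at level 2^j have measure 2^-j,
    so the fiber measures vary continuously near a^oo. Finally, distinct translates of E must hardly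
    meet. Powers of a preserve the axis along which E accumulates, which is why the exponents form a
    Sidon set; for any other element, the first letter leaving that axis already pins down a
    level. *)

Section GroupTheory.
Variable G : group.
Implicit Types x y z : G.

Lemma gmulgV x : gmul x (ginv x) = gone G.
Proof.
rewrite -(gmul1g (gmul x (ginv x))) -{1}(gmulVg (ginv x)) -gmulA.
by rewrite (gmulA (ginv x)) gmulVg gmul1g gmulVg.
Qed.

Lemma gmulg1 x : gmul x (gone G) = x.
Proof. by rewrite -(gmulVg x) gmulA gmulgV gmul1g. Qed.

Lemma gmulKg x y : gmul (ginv x) (gmul x y) = y.
Proof. by rewrite gmulA gmulVg gmul1g. Qed.

Lemma gmulVKg x y : gmul x (gmul (ginv x) y) = y.
Proof. by rewrite gmulA gmulgV gmul1g. Qed.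

Lemma gmulgI x y z : gmul x y = gmul x z -> y = z.
Proof. by move=> /(congr1 (gmul (ginv x))); rewrite !gmulKg. Qed.

Lemma ginv_unique x y : gmul x y = gone G -> x = ginv y.
Proof. by move=> H; rewrite -(gmulg1 x) -(gmulgV y) gmulA H gmul1g. Qed.

Lemma ginvK x : ginv (ginv x) = x.
Proof. by apply/esym/ginv_unique; rewrite gmulgV. Qed.

Lemma ginvM x y : ginv (gmul x y) = gmul (ginv y) (ginv x).
Proof. by apply/esym/ginv_unique; rewrite -gmulA gmulKg gmulVg. Qed.

Lemma ginv1 : ginv (gone G) = gone G.
Proof. by apply/esym/ginv_unique; rewrite gmul1g. Qed.

End GroupTheory.

Lemma group_hom1 (G H : group) (h : G -> H) : group_hom h -> h (gone G) = gone H.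
Proof. by move=> hh; apply: (@gmulgI _ (h (gone G))); rewrite -hh !gmulg1. Qed.

Lemma group_homV (G H : group) (h : G -> H) x :
  group_hom h -> h (ginv x) = ginv (h x).
Proof. by move=> hh; apply: ginv_unique; rewrite -hh gmulVg group_hom1. Qed.

HB.instance Definition _ (G : group) := gen_eqMixin (gcar G).
HB.instance Definition _ (G : group) := gen_choiceMixin (gcar G).

(** The inverse is stored as data, so that self-bijections form a [group]; choosing one per basis
    element then gives an action of the free group by its universal property. *)
Record selfbij (T : Type) := SelfBij {
  bfun :> T -> T;
  binv : T -> T;
  bfunK : cancel bfun binv;
  binvK : cancel binv bfun }.

Lemma bij_eq (T : Type) (f g : selfbij T) : (forall x, f x = g x) -> f = g.
Proof.
case: f g => [f f' fK f'K] [g g' gK g'K] /= /funext fg.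
have fg' : f' = g'.
  by apply/funext => x; rewrite -{1}(g'K x) -fg fK.
by subst; congr SelfBij; exact: Prop_irrelevance.
Qed.

Section BijGroup.
Variable T : Type.

Definition bij_one : selfbij T := @SelfBij T id id (fun=> erefl) (fun=> erefl).

Definition bij_mul (f g : selfbij T) : selfbij T :=
  @SelfBij T (f \o g) (binv g \o binv f)
    (can_comp (bfunK f) (bfunK g)) (can_comp (binvK g) (binvK f)).

Definition bij_inv (f : selfbij T) : selfbij T := SelfBij (binvK f) (bfunK f).

Lemma bij_mulA f g h : bij_mul f (bij_mul g h) = bij_mul (bij_mul f g) h.
Proof. exact: bij_eq. Qed.

Lemma bij_mul1 f : bij_mul bij_one f = f.
Proof. exact: bij_eq. Qed.

Lemma bij_mulV f : bij_mul (bij_inv f) f = bij_one.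
Proof. by apply: bij_eq => x /=; rewrite bfunK. Qed.

Definition bij_group : group :=
  @Defs.Group (selfbij T) bij_mul bij_one bij_inv bij_mulA bij_mul1 bij_mulV.

End BijGroup.

(** * Words in a free basis *)

Section FreeGroup.
Variables (G : group) (n : nat) (e : 'I_n -> G).
Hypothesis he : free_basis e.

(** [(i, true)] stands for the basis element [e i], and [(i, false)] for its inverse. *)
Definition letter : Type := ('I_n * bool)%type.
HB.instance Definition _ := Finite.on letter.
Implicit Types (l : letter) (w : seq letter).

Definition linv l : letter := (l.1, ~~ l.2).

Lemma linvK : involutive linv.
Proof. by case=> i b; rewrite /linv /= negbK. Qed.

Lemma linv_neq l : linv l != l.
Proof. by case: l => i b; apply/eqP => -[]; case: b. Qed.

Definition gen l : G := if l.2 then e l.1 else ginv (e l.1).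

Lemma gen_linv l : gen (linv l) = ginv (gen l).
Proof. by case: l => i []; rewrite /gen /= ?ginvK. Qed.

Definition weval w : G := foldr (fun l g => gmul (gen l) g) (gone G) w.

Lemma weval_cat w1 w2 : weval (w1 ++ w2) = gmul (weval w1) (weval w2).
Proof. by elim: w1 => [|l w1 IH] /=; rewrite ?gmul1g // IH gmulA. Qed.

Lemma weval_inv w : ginv (weval w) = weval (rev (map linv w)).
Proof.
elim: w => [|l w IH] /=; first by rewrite ginv1.
by rewrite ginvM IH rev_cons -cats1 weval_cat /= gen_linv gmulg1.
Qed.

(* The words evaluate to a subgroup through which the identity factors, by the
   uniqueness part of the universal property. *)
Lemma weval_surj g : exists w, weval w = g.
Proof.
pose S := {g : G | exists w, weval w = g}.
have mulP (x y : S) : exists w, weval w = gmul (sval x) (sval y).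
  have [[u <-] [v <-]] := (svalP x, svalP y).
  by exists (u ++ v); rewrite weval_cat.
have oneP : exists w, weval w = gone G by exists [::].
have invP (x : S) : exists w, weval w = ginv (sval x).
  by have [u <-] := svalP x; exists (rev (map linv u)); rewrite weval_inv.
have Seq (x y : S) : sval x = sval y -> x = y.
  by case: x y => [x xP] [y yP] /= xy; subst; congr exist; exact: Prop_irrelevance.
pose smul (x y : S) : S := exist _ _ (mulP x y).
pose sone : S := exist _ _ oneP.
pose sinv (x : S) : S := exist _ _ (invP x).
have smulA x y z : smul x (smul y z) = smul (smul x y) z.
  by apply: Seq; rewrite /= gmulA.
have smul1 x : smul sone x = x by apply: Seq; rewrite /= gmul1g.
have smulV x : smul (sinv x) x = sone by apply: Seq; rewrite /= gmulVg.
pose SG := @Defs.Group S smul sone sinv smulA smul1 smulV.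
have genP i : exists w, weval w = e i by exists [:: (i, true)]; rewrite /= gmulg1.
have [h [[hh hE] _]] := he (fun i => exist _ _ (genP i) : SG).
have [h' [_ hU]] := he e.
have E1 : h' = id by apply: hU; split.
have E2 : h' = (fun g => sval (h g)).
  by apply: hU; split=> [x y|i]; rewrite ?hh ?hE.
by move: (svalP (h g)); rewrite -[sval (h g)]/((fun g => sval (h g)) g) -E2 E1.
Qed.

Lemma gen_ind (P : G -> Prop) : P (gone G) ->
  (forall l g, P g -> P (gmul (gen l) g)) -> forall g, P g.
Proof.
by move=> P1 PS g; have [w <-] := weval_surj g; elim: w => //= l w; exact: PS.
Qed.

Definition rword w := sorted (fun l l' => l' != linv l) w.

Lemma rword_surj g : exists2 w, rword w & weval w = g.
Proof.
elim/gen_ind: g => [|l g [w rw <-]]; first by exists [::].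
case: w rw => [|l' w] rw; first by exists [:: l].
have [E|N] := eqVneq l' (linv l); last by exists [:: l, l' & w] => //=; rewrite N.
exists w; first exact: (path_sorted rw).
by rewrite /= E gen_linv gmulVKg.
Qed.

Section Action.
Variables (T : Type) (f : 'I_n -> selfbij T).

Definition free_act : G -> T -> T :=
  fun g => bfun (sval (cid (he (f : 'I_n -> bij_group T))) g).

Lemma free_act_hom : group_hom (sval (cid (he (f : 'I_n -> bij_group T)))).
Proof. by case: cid => h [[]]. Qed.

Lemma free_actM g h x : free_act (gmul g h) x = free_act g (free_act h x).
Proof. by rewrite /free_act free_act_hom. Qed.

Lemma free_act1 x : free_act (gone G) x = x.
Proof. by rewrite /free_act (group_hom1 free_act_hom). Qed.

Lemma free_actK g x : free_act (ginv g) (free_act g x) = x.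
Proof. by rewrite -free_actM gmulVg free_act1. Qed.

Lemma free_actVK g x : free_act g (free_act (ginv g) x) = x.
Proof. by rewrite -free_actM gmulgV free_act1. Qed.

Lemma free_act_gen l x :
  free_act (gen l) x = if l.2 then f l.1 x else binv (f l.1) x.
Proof.
have E i : sval (cid (he (f : 'I_n -> bij_group T))) (e i) = f i.
  by case: cid => h /= [[_ hE] _].
case: l => i [] /=; rewrite /free_act /gen /=; first by rewrite E.
by rewrite (group_homV _ free_act_hom) /= E.
Qed.

End Action.

End FreeGroup.

(** * The boundary of the free group *)

Record ray (n : nat) := Ray {
  rayv :> nat -> letter n;
  rayP : forall i, rayv i.+1 != linv (rayv i) }.

Lemma ray_eq n (y z : ray n) : (forall i, y i = z i) -> y = z.
Proof.
case: y z => [y yP] [z zP] /= /funext yz; subst.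
by congr Ray; exact: Prop_irrelevance.
Qed.

Lemma ray_neqP n (y z : ray n) : y <> z -> exists i, y i <> z i.
Proof.
move=> N; apply: contrapT => H; apply: N; apply: ray_eq => i.
by apply: contrapT => Hi; apply: H; exists i.
Qed.

Section LetterAction.
Variable n : nat.
Implicit Types (l : letter n) (y : ray n).

(** Left multiplication by [l] on infinite reduced words: an initial inverse of [l] cancels,
    otherwise [l] is prepended. *)
Definition rcons_fun l y i : letter n :=
  if y 0%N == linv l then y i.+1 else if i is j.+1 then y j else l.

Lemma rcons_funP l y i : rcons_fun l y i.+1 != linv (rcons_fun l y i).
Proof.
rewrite /rcons_fun; case: ifP => [_|/negbT N]; first exact: rayP.
by case: i => [|i] //; exact: rayP.
Qed.

Definition rpush l y : ray n := Ray (rcons_funP l y).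

Lemma rpush_cons l y : y 0%N != linv l ->
  forall i, rpush l y i = if i is j.+1 then y j else l.
Proof. by move=> /negbTE N i; rewrite /= /rcons_fun N. Qed.

Lemma rpush_shift l y : y 0%N = linv l -> forall i, rpush l y i = y i.+1.
Proof. by move=> E i; rewrite /= /rcons_fun E eqxx. Qed.

Lemma rpushK l : cancel (rpush l) (rpush (linv l)).
Proof.
move=> y; apply: ray_eq => i.
have [E|N] := eqVneq (y 0%N) (linv l).
  rewrite rpush_cons; first by case: i => [|i]; rewrite ?E // rpush_shift.
  by rewrite rpush_shift // -E rayP.
by rewrite rpush_shift ?linvK rpush_cons.
Qed.

Lemma rpushVK l : cancel (rpush (linv l)) (rpush l).
Proof. by move=> y; rewrite -{1}(linvK l) rpushK. Qed.

Definition rpush_bij (i : 'I_n) : selfbij (ray n) :=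
  SelfBij (rpushK (i, true)) (rpushVK (i, true)).

Lemma const_rayP l (i : nat) : l != linv l.
Proof. by rewrite eq_sym linv_neq. Qed.

Definition const_ray l : ray n := @Ray n (fun=> l) (const_rayP l).

End LetterAction.

(** * The dyadic odometer *)

Section Odometer.
Implicit Types k : nat -> bool.

(** The carry into bit [i] when one is added to the 2-adic integer with bits [k]; on complemented
    bits it is the borrow of a subtraction. *)
Fixpoint allp k i := if i is j.+1 then allp k j && k j else true.

Definition add1 k i := k i (+) allp k i.
Definition sub1 k i := k i (+) allp (fun j => ~~ k j) i.

Lemma allp_add1 k i : allp (fun j => ~~ add1 k j) i = allp k i.
Proof. by elim: i => //= i ->; rewrite /add1; case: (allp k i); case: (k i). Qed.

Lemma allp_sub1 k i : allp (sub1 k) i = allp (fun j => ~~ k j) i.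
Proof. by elim: i => //= i ->; rewrite /sub1; case: (allp _ i); case: (k i). Qed.

Lemma add1K : cancel add1 sub1.
Proof.
by move=> k; apply/funext => i; rewrite /sub1 allp_add1 /add1 addbK.
Qed.

Lemma sub1K : cancel sub1 add1.
Proof.
by move=> k; apply/funext => i; rewrite /add1 allp_sub1 /sub1 addbK.
Qed.

Definition add1_bij : selfbij (nat -> bool) := SelfBij add1K sub1K.

Definition bagree m k k' := forall i, (i < m)%N -> k i = k' i.

Lemma allp_agree m k k' : bagree m k k' -> allp k m = allp k' m.
Proof.
elim: m => //= m IH H; rewrite IH ?H // => i im; apply: H; exact: ltnW.
Qed.

Lemma bagreeW m m' k k' : (m <= m')%N -> bagree m' k k' -> bagree m k k'.
Proof. by move=> mm H i im; apply: H; apply: leq_trans mm. Qed.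

Lemma add1_agree m k k' : bagree m k k' -> bagree m (add1 k) (add1 k').
Proof.
move=> H i im; rewrite /add1 H //; congr addb; apply: allp_agree.
by apply: bagreeW H; exact: ltnW.
Qed.

Lemma sub1_agree m k k' : bagree m k k' -> bagree m (sub1 k) (sub1 k').
Proof.
move=> H i im; rewrite /sub1 H //; congr addb; apply: allp_agree => j ji.
by rewrite H //; apply: ltn_trans im.
Qed.

Fixpoint bval k m := if m is j.+1 then (bval k j + k j * 2 ^ j)%N else 0%N.

Lemma bval_lt k m : (bval k m < 2 ^ m)%N.
Proof. elim: m => //= m IH; rewrite expnS; case: (k m); lia. Qed.

Lemma bval_inj k k' m : bval k m = bval k' m -> bagree m k k'.
Proof.
elim: m => //= m IH H.
have Hk : k m = k' m.
  have := bval_lt k m; have := bval_lt k' m; move: H.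
  by case: (k m); case: (k' m) => //=; lia.
move=> i; rewrite ltnS leq_eqVlt => /orP[/eqP->//|]; apply: IH.
by move: H; rewrite Hk => /addIn.
Qed.

Lemma bval_allp k m : allp k m = ((bval k m).+1 == 2 ^ m)%N.
Proof.
elim: m => //= m ->; have := bval_lt k m; rewrite expnS.
by case: (k m) => /=; rewrite ?andbT ?andbF => H; apply/eqP/eqP; lia.
Qed.

Lemma bval_add1 k m : bval (add1 k) m = ((bval k m).+1 %% 2 ^ m)%N.
Proof.
elim: m => [|m IH] /=; first by rewrite modn1.
rewrite IH /add1 bval_allp; have := bval_lt k m; rewrite expnS => H.
have [E|N] := eqVneq (bval k m).+1 (2 ^ m)%N.
  rewrite E modnn; case: (k m) => /=.
    by rewrite (_ : (_ + _).+1 = (2 * 2 ^ m)%N) ?modnn //; lia.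
  by rewrite modn_small; lia.
rewrite modn_small; last by lia.
by case: (k m) => /=; rewrite modn_small //; lia.
Qed.

Lemma bval_iter j k m : bval (iter j add1 k) m = ((bval k m + j) %% 2 ^ m)%N.
Proof.
elim: j => [|j IH] /=; first by rewrite addn0 modn_small ?bval_lt.
by rewrite bval_add1 IH -addn1 modnDml addn1 addnS.
Qed.

Lemma odometer_transitive k c m : exists j, (0 < j)%N /\ bagree m (iter j add1 k) c.
Proof.
have := bval_lt k m; have := bval_lt c m => Hc Hk.
exists (2 ^ m - bval k m + bval c m)%N; split; first lia.
apply: bval_inj; rewrite bval_iter addnA subnKC; last exact: ltnW.
by rewrite modnDl modn_small.
Qed.

(** Since [0 < j < 2 ^ j], the shift by [j] already moves every residue modulo [2 ^ j]. *)
Lemma iter_add1_neq j k : (0 < j)%N -> iter j add1 k <> k.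
Proof.
move=> j0 /(congr1 (fun k => bval k j)); rewrite bval_iter => H.
have jlt : (j < 2 ^ j)%N by apply: ltn_expl.
have := bval_lt k j => kl.
have [h|h] := ltnP (bval k j + j) (2 ^ j)%N.
  by move: H; rewrite modn_small; lia.
move: H; rewrite -(subnK h) modnDr modn_small; lia.
Qed.

End Odometer.

Definition k0 : nat -> bool := fun=> false.

(** * The actions of the free group on its boundary and on the odometer *)

Section FreeActions.
Variables (G : group) (n : nat) (e : 'I_n -> G).
Hypothesis he : free_basis e.
Implicit Types (l : letter n) (y z : ray n) (g h : G) (w : seq (letter n)).
Implicit Types k : nat -> bool.

Definition ay : G -> ray n -> ray n := free_act he (@rpush_bij n).
Definition ak : G -> (nat -> bool) -> nat -> bool := free_act he (fun=> add1_bij).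

Lemma ay_gen l y : ay (gen e l) y = rpush l y.
Proof. by rewrite /ay free_act_gen; case: l => i []. Qed.

Lemma ak_gen l k : ak (gen e l) k = if l.2 then add1 k else sub1 k.
Proof. by rewrite /ak free_act_gen; case: l => i []. Qed.

Lemma ayM g h y : ay (gmul g h) y = ay g (ay h y). Proof. exact: free_actM. Qed.
Lemma akM g h k : ak (gmul g h) k = ak g (ak h k). Proof. exact: free_actM. Qed.
Lemma ay1 y : ay (gone G) y = y. Proof. exact: free_act1. Qed.
Lemma ak1 k : ak (gone G) k = k. Proof. exact: free_act1. Qed.
Lemma ayK g y : ay (ginv g) (ay g y) = y. Proof. exact: free_actK. Qed.
Lemma akK g k : ak (ginv g) (ak g k) = k. Proof. exact: free_actK. Qed.
Lemma akVK g k : ak g (ak (ginv g) k) = k. Proof. exact: free_actVK. Qed.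

Definition yagree m y z := forall i, (i < m)%N -> y i = z i.

Lemma yagreeW m m' y z : (m <= m')%N -> yagree m' y z -> yagree m y z.
Proof. by move=> mm H i im; apply: H; apply: leq_trans mm. Qed.

Lemma ay_modulus g m :
  exists M, forall y z, yagree M y z -> yagree m (ay g y) (ay g z).
Proof.
elim/(gen_ind he): g m => [|l g IH] m; first by exists m => y z; rewrite !ay1.
have [M HM] := IH m.+1; exists M => y z /HM H i im.
rewrite !ayM !ay_gen /= /rcons_fun H // H //; case: ifP => // _.
by case: i im => // i im; apply: H; lia.
Qed.

(** Adding or subtracting one is an isometry of the odometer, hence so is every group element:
    unlike in [ay_modulus], no precision is lost. *)
Lemma ak_agree g m k k' : bagree m k k' -> bagree m (ak g k) (ak g k').
Proof.
elim/(gen_ind he): g k k' => [|l g IH] k k'; first by rewrite !ak1.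
by move=> /IH H; rewrite !akM !ak_gen; case: l.2; [exact: add1_agree|exact: sub1_agree].
Qed.

(** The second hypothesis rules out cancellation between [w] and [y], so the image is their
    concatenation. With [y 0] as the default of [last] it holds for the empty word, because no
    letter is its own inverse. *)
Lemma ay_rword w y : rword w ->
  y 0%N != linv (last (y 0%N) w) ->
  forall i, ay (weval e w) y i =
    if (i < size w)%N then nth (y 0%N) w i else y (i - size w)%N.
Proof.
elim: w => [|l w IH] rw hy i; first by rewrite /= ay1 subn0.
rewrite /= ayM ay_gen; have {}IH := IH (path_sorted rw).
case: w rw hy IH => [|l' w] rw hy IH.
  by rewrite rpush_cons /= ay1; case: i => [|i] //; rewrite subn1.
rewrite rpush_cons; first by case: i => [|i] //; rewrite (IH hy).
by rewrite (IH hy) /=; case/andP: rw.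
Qed.

Lemma ay_rword_head l w y : rword (l :: w) -> y 0%N != linv (last l w) ->
  ay (weval e (l :: w)) y 0%N = l.
Proof. by move=> rw hy; rewrite ay_rword. Qed.

(* A nontrivial element maps all first-letter cylinders but one into a single
   one: that of its first letter. *)
Lemma letter_noncrossing g g' l l' : exists b b' : bool,
  forall y, ~ ((ay g y 0%N == l) = b /\ (ay g' y 0%N == l') = b').
Proof.
have [[|u w] rw hw] := rword_surj he (gmul g' (ginv g)).
  have E : g' = g by rewrite -(gmulg1 g') -(gmulVg g) gmulA -hw gmul1g.
  rewrite E; have [->|N] := eqVneq l l'.
    by exists true, false => y [->].
  by exists true, true => y [/eqP->]; rewrite (negbTE N).
have H y : ay g y 0%N != linv (last u w) -> ay g' y 0%N = u.
  move=> hy; rewrite -[RHS](ay_rword_head rw hy) hw -ayM -gmulA gmulVg.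
  by rewrite gmulg1.
have [E|N] := eqVneq l (linv (last u w)).
  exists false, (u != l') => y [/negbT h1]; rewrite H -?E //.
  by case: (u == l').
exists true, (u != l') => y [/eqP h1]; rewrite H ?h1 //.
by case: (u == l').
Qed.

Hypothesis hn : (2 <= n)%N.

Definition i0 : 'I_n := Ordinal (ltn_trans (ltnSn 0) hn).
Definition i1 : 'I_n := Ordinal hn.
Definition la : letter n := (i0, true).
Definition lb : letter n := (i1, true).

Lemma letter_avoid l l' : exists t : letter n, t != l /\ t != l'.
Proof.
have A : la != lb by [].
have B : la != linv la by [].
have C : lb != linv la by [].
have [E1|N1] := eqVneq la l; have [E2|N2] := eqVneq la l'; last by exists la.
- by exists lb; rewrite -E1 -E2.
- have [E3|N3] := eqVneq lb l'; last by exists lb; rewrite -E1.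
  by exists (linv la); rewrite -E1 -E3.
- have [E3|N3] := eqVneq lb l; last by exists lb; rewrite -E2.
  by exists (linv la); rewrite -E2 -E3.
Qed.

Lemma ay_effective g h : g <> h -> exists y, ay g y <> ay h y.
Proof.
move=> gh; have [[|u w] rw hw] := rword_surj he (gmul (ginv h) g).
  by case: gh; rewrite -(gmulVKg h g) -hw gmulg1.
have [t [tu tw]] := letter_avoid u (linv (last u w)).
(* The image of t^oo starts with [u], because [t] does not cancel the last letter of the word; as
   [t] differs from [u], the point moves. *)
exists (const_ray t) => E.
have := ay_rword_head (y := const_ray t) rw tw.
by rewrite hw ayM E ayK /= => /eqP; rewrite (negbTE tu).
Qed.

Lemma iter_gmul_act g j :
  (forall y, ay (iter j (gmul g) (gone G)) y = iter j (ay g) y) /\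
  (forall k, ak (iter j (gmul g) (gone G)) k = iter j (ak g) k).
Proof.
by elim: j => [|j [IH1 IH2]]; split=> x /=; rewrite ?ay1 ?ak1 ?ayM ?akM ?IH1 ?IH2.
Qed.

Lemma rword_mkseq y m : rword (mkseq y m).
Proof.
apply/(sortedP (y 0%N)) => i; rewrite size_mkseq => im.
by rewrite !nth_mkseq ?rayP //; lia.
Qed.

(** The element is z|m t^j s. The letter [s] cancels neither into [y] nor against [t], so t^j with j
    positive shields the prefix z|m from [y]; and [t] is a basis element, so [j] steers the odometer
    to [c]. *)
Lemma orbit_dense y k z c m : exists g,
  yagree m (ay g y) z /\ bagree m (ak g k) c.
Proof.
have [t [tz tt]] : exists t : letter n, t != linv (z m.-1) /\ t.2.
  have [E|N] := eqVneq la (linv (z m.-1)); last by exists la.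
  by exists lb; rewrite -E.
have [s [s1 s2]] := letter_avoid (linv t) (linv (y 0%N)).
pose y' := rpush s y.
have y'0 : y' 0%N = s.
  rewrite rpush_cons //; apply: contraNneq s2 => ->; by rewrite linvK.
pose k' := ak (gmul (weval e (mkseq z m)) (gen e s)) k.
have [j [j0 Hj]] := odometer_transitive k' c m.
pose u := iter j (gmul (gen e t)) (gone G).
exists (gmul (weval e (mkseq z m)) (gmul u (gen e s))); split; last first.
  (* Every basis element adds one, so the action on the odometer factors through the integers and is
     insensitive to the order of factors. *)
  have akC g h x : ak (gmul g h) x = ak (gmul h g) x.
    have C1 l : forall x, ak (gen e l) (add1 x) = add1 (ak (gen e l) x).
      by move=> q; rewrite !ak_gen; case: l.2; rewrite ?sub1K ?add1K.
    have C2 h' : forall x, ak h' (add1 x) = add1 (ak h' x).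
      by elim/(gen_ind he): h' => [|l h' IH] q; rewrite ?ak1 // !akM IH C1.
    have C3 h' : forall x, ak h' (sub1 x) = sub1 (ak h' x).
      by move=> q; rewrite -{2}(sub1K q) C2 add1K.
    elim/(gen_ind he): g x => [|l g IH] x; first by rewrite gmul1g gmulg1.
    by rewrite -gmulA akM IH akM -akM !akM !ak_gen; case: l.2; rewrite ?C2 ?C3.
  have E : ak (gmul (weval e (mkseq z m)) (gmul u (gen e s))) k = iter j add1 k'.
    rewrite gmulA akM akC -akM -gmulA akM.
    rewrite (iter_gmul_act _ _).2 /k'; elim: (j) => //= i ->.
    by rewrite ak_gen tt.
  by rewrite E.
move=> i im; rewrite !ayM (iter_gmul_act _ _).1 ay_gen -/y'.
have H : iter j (ay (gen e t)) y' 0%N = t.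
  case: j j0 {Hj u} => // j _; elim: j => [|j IH].
    by rewrite /= ay_gen rpush_cons // y'0.
  rewrite iterS ay_gen rpush_cons // IH; exact: (const_rayP t 0).
rewrite ay_rword ?rword_mkseq //; first by rewrite size_mkseq im nth_mkseq.
case: m im tz {Hj k'} => // m im tz; rewrite H mkseqS last_rcons.
by [].
Qed.

End FreeActions.

(** * The axis of the generator a, the stabilizer of a^oo, and levels *)

Section Axis.
Variables (G : group) (n : nat) (e : 'I_n -> G).
Hypotheses (hn : (2 <= n)%N) (he : free_basis e).
Implicit Types (l : letter n) (y z : ray n) (g h : G) (w : seq (letter n)).
Implicit Types k : nat -> bool.
Implicit Types s t : int.
Local Notation ay := (ay he).
Local Notation ak := (ak he).
Local Notation i0 := (i0 hn).
Local Notation la := (la hn).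
Local Notation lb := (lb hn).
Local Notation ga := (gen e la).

Definition apow (t : int) : G :=
  match t with
  | Posz j => iter j (gmul ga) (gone G)
  | Negz j => iter j.+1 (gmul (ginv ga)) (gone G)
  end.

Lemma apowS t : apow (t + 1) = gmul ga (apow t).
Proof.
case: t => [j|[|j]]; first by rewrite addrC -intS.
  by rewrite /= gmulg1 gmulgV.
by rewrite NegzE (_ : (- j.+2%:Z + 1)%R = Negz j) /= ?gmulVKg // NegzE; lia.
Qed.

Lemma apowP t : apow (t - 1) = gmul (ginv ga) (apow t).
Proof. by rewrite -{2}(subrK 1 t)%R apowS gmulKg. Qed.

Lemma apowD s t : apow (s + t) = gmul (apow s) (apow t).
Proof.
elim/int_ind: s => [|j IH|j IH]; first by rewrite add0r gmul1g.
  by rewrite intS -addrA addrC apowS IH gmulA -apowS addrC.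
rewrite (_ : - j.+1%:Z + t = (- j%:Z + t) - 1)%R; last lia.
by rewrite apowP IH gmulA -apowP; congr (gmul (apow _) _); lia.
Qed.

Lemma ay_apow_pos y t : (0 < t)%R -> y 0%N != linv la -> ay (apow t) y 0%N = la.
Proof.
case: t => // -[//|j] _ hy; elim: j => [|j IH].
  by rewrite /= gmulg1 ay_gen rpush_cons.
by rewrite intS addrC apowS ayM ay_gen rpush_cons // IH (const_rayP la 0).
Qed.

Lemma ay_apow_neg y t : (t < 0)%R -> y 0%N != la -> ay (apow t) y 0%N = linv la.
Proof.
case: t => // j _ hy; elim: j => [|j IH].
  by rewrite /= gmulg1 -gen_linv ay_gen rpush_cons ?linvK.
rewrite /= ayM -gen_linv ay_gen rpush_cons //.
by rewrite gen_linv IH (const_rayP (linv la) 0).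
Qed.

Lemma ay_apow_axis y t : (t != 0)%R -> (y 0%N).1 != i0 -> (ay (apow t) y 0%N).1 = i0.
Proof.
move=> t0 hy; have [tp|tn|] := ltgtP t 0%R; last by move=> E; rewrite E eqxx in t0.
  by rewrite ay_apow_neg //; apply: contraNneq hy => ->.
by rewrite ay_apow_pos //; apply: contraNneq hy => ->.
Qed.

Lemma letter_axis l : l.1 = i0 -> l = la \/ l = linv la.
Proof. by case: l => i [] /= ->; [left|right]. Qed.

(* [t] and [s] are the exponents of the leading and trailing powers of a in the
   reduced word of [g]. *)
Lemma axis_normal_form g : (exists t, g = apow t) \/
  exists s t h l, [/\ g = gmul (apow t) (gmul h (apow s)), l.1 != i0 &
    forall y, (y 0%N).1 = i0 -> ay h y 0%N = l].
Proof.
(* Invariant tying the exponent [t] to the reduced word [w]: its sign tells whether [w] starts with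
   a or a^-1, and when it vanishes [o] is the first letter. Reducedness then keeps prepended letters
   from cancelling. *)
pose sgn t w o := [\/ t = 0%R /\ ohead w = o,
   (0 < t)%R /\ ohead w = Some la | (t < 0)%R /\ ohead w = Some (linv la)].
suff H w : rword w ->
  (exists t, weval e w = apow t /\ sgn t w None) \/
  exists s t h l, [/\ weval e w = gmul (apow t) (gmul h (apow s)), l.1 != i0,
    forall y, (y 0%N).1 = i0 -> ay h y 0%N = l & sgn t w (Some l)].
  have [w rw <-] := rword_surj he g; have [[t [E _]]|[s [t [h [l [H1 H2 H3 _]]]]]] := H w rw.
    by left; exists t.
  by right; exists s, t, h, l.
elim: w => [|u w IH] rw; first by left; exists 0%R; split=> //; constructor 1.
have {}IH := IH (path_sorted rw).
have [Eu|Nu] := eqVneq u.1 i0.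
  pose d : int := if u.2 then 1%R else (-1)%R.
  have step t o : sgn t w o -> sgn (t + d)%R (u :: w) o /\
      gmul (gen e u) (apow t) = apow (t + d)%R.
    rewrite /d => sg; have [E|E] := letter_axis Eu; rewrite E /=; split.
    - constructor 2; split=> //; case: sg => -[h1 h2]; try lia.
      by move: rw; case: (w) h2 => //= v w' [->]; rewrite E eqxx.
    - by rewrite apowS.
    - constructor 3; split=> //; case: sg => -[h1 h2]; try lia.
      by move: rw; case: (w) h2 => //= v w' [->]; rewrite E linvK eqxx.
    - by rewrite apowP -gen_linv.
  case: IH => [[t [E /step[sg gE]]]|[s [t [h [l [E ln hl /step[sg gE]]]]]]].
    by left; exists (t + d)%R; rewrite /= E.
  by right; exists s, (t + d)%R, h, l; rewrite /= E gmulA gE.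
right; case: IH => [[t [E sg]]|[s [t [h [l [E ln hl sg]]]]]].
  exists t, 0%R, (gen e u), u; split=> //; rewrite /= ?E ?gmul1g //; last by constructor 1.
  move=> y hy; rewrite ay_gen rpush_cons //.
  by apply: contraNneq Nu => E'; move: hy; rewrite E' => <-.
exists s, 0%R, (gmul (gen e u) (gmul (apow t) h)), u; split=> //.
- by rewrite /= E gmul1g -!gmulA.
- move=> y hy; rewrite !ayM ay_gen rpush_cons //.
  have [t0|t0] := eqVneq t 0%R.
    rewrite t0 ay1 hl //; case: sg => -[h1 h2]; try lia.
    by move: rw; case: (w) h2 => //= v w' [->] /andP[].
  have := @ay_apow_axis (ay h y) t t0; rewrite hl // => /(_ ln) E'.
  by apply: contraNneq Nu => E2; move: E'; rewrite E2 => <-.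
- by constructor 1.
Qed.

Definition ainf : ray n := const_ray la.

Lemma ay_apow_ainf t : ay (apow t) ainf = ainf.
Proof.
have H : ay ga ainf = ainf.
  apply: ray_eq => i; rewrite ay_gen rpush_cons; first by case: i.
  exact: (const_rayP la 0).
elim/int_ind: t => [|j IH|j IH]; first by rewrite ay1.
  by rewrite intS addrC apowS ayM IH.
rewrite (_ : - j.+1%:Z = - j%:Z - 1)%R; last lia.
by rewrite apowP ayM IH -{1}H ayK.
Qed.

Lemma ay_stab_ainf g : ay g ainf = ainf -> exists t, g = apow t.
Proof.
have [//|[s [t [h [l [-> ln hl]]]]]] := axis_normal_form g.
rewrite !ayM ay_apow_ainf => /(congr1 (ay (apow (- t)))).
rewrite -ayM -apowD addNr ay1 ay_apow_ainf => E.
by have := hl ainf erefl; rewrite E => E'; move: ln; rewrite -E' eqxx.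
Qed.

Lemma ak_apow_neq t k : (t != 0)%R -> ak (apow t) k <> k.
Proof.
have H j : forall q, iter j (ak ga) q = iter j add1 q.
  by elim: j => //= j IH q; rewrite IH ak_gen.
move=> t0 E.
have [j [j0 Ej]] : exists j, (0 < j)%N /\ iter j add1 k = k.
  case: t t0 E => [j|j] t0 E.
    by exists j; split; [case: j t0 E|rewrite -H -(iter_gmul_act he ga j).2].
  exists j.+1; split=> //; rewrite -H -(iter_gmul_act he ga j.+1).2.
  rewrite -[iter _ _ _]/(apow j.+1) -{1}E -akM -apowD NegzE addrN.
  by rewrite ak1.
exact: iter_add1_neq Ej.
Qed.

(** The stabilizer of a^oo consists of powers of a, and a nonzero power of a acts on the odometer as
    a nonzero translation. *)
Lemma orbit_free g k : ay g ainf = ainf -> ak g k = k -> g = gone G.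
Proof.
move=> /ay_stab_ainf[t ->]; have [->//|t0] := eqVneq t 0%R.
by move/ak_apow_neq => /(_ t0).
Qed.

(* [level c y]: y starts with a^c b when c >= 0 *)
Definition level (c : int) y := ay (apow (- c)) y 0%N = lb.

Lemma level_nat (j : nat) y : level j y <-> (forall i, (i < j)%N -> y i = la) /\ y j = lb.
Proof.
rewrite /level; elim: j y => [|j IH] y.
  by rewrite oppr0 ay1; split=> [//|[]].
have lab : la != lb by [].
rewrite (_ : - j.+1%:Z = - j%:Z - 1)%R; last lia.
have -> : apow (- j%:Z - 1) = gmul (apow (- j%:Z)) (ginv ga).
  by rewrite apowD -[apow (-1)]/(gmul (ginv ga) (gone G)) gmulg1.
rewrite ayM; apply: (iff_trans (IH _)); rewrite -gen_linv ay_gen.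
have [E|N] := eqVneq (y 0%N) la.
  have H i : rpush (linv la) y i = y i.+1 by rewrite rpush_shift // linvK.
  rewrite H; split=> -[h1 h2]; split=> //.
    by case=> [//|i] ij; rewrite -H h1.
  by move=> i ij; rewrite H h1.
have H : rpush (linv la) y 0%N = linv la by rewrite rpush_cons // linvK.
split=> [[h1 h2]|[h1 _]]; last by rewrite h1 // eqxx in N.
by case: j {IH} h1 h2 => [|j] h1 h2; [move: h2|move: (h1 0%N isT)]; rewrite H.
Qed.

(** A nonzero power of a takes a ray starting off the axis of a to one starting on it, so a ray
    cannot leave the axis at two places. *)
Lemma level_uniq c c' y : level c y -> level c' y -> c = c'.
Proof.
rewrite /level => h1 h2; apply/eqP; apply/negPn/negP => N.
have t0 : (c - c')%R != 0%R by rewrite subr_eq0.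
have := @ay_apow_axis (ay (apow (- c)) y) (c - c')%R t0.
rewrite h1 -ayM -apowD (_ : c - c' + - c = - c')%R; last lia.
by rewrite h2 => /(_ isT).
Qed.

Lemma level_ainf c : ~ level c ainf.
Proof. by rewrite /level ay_apow_ainf => -[]. Qed.

Lemma level_apow c t y : level c y <-> level (c + t)%R (ay (apow t) y).
Proof. by rewrite /level -ayM -apowD (_ : - (c + t) + t = - c)%R; last lia. Qed.

(** Once each pair is ordered, the sum determines the larger exponent, as 2^b < 2^a + 2^b <= 2^(b+1)
    for a <= b. *)
Lemma pow2_sum_inj a b c d : (2 ^ a + 2 ^ b = 2 ^ c + 2 ^ d)%N ->
  (a = c /\ b = d) \/ (a = d /\ b = c).
Proof.
wlog ab : a b / (a <= b)%N.
  move=> W H; have [ab|ba] := leqP a b; first exact: W.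
  by have [||[-> ->]|[-> ->]] := W b a; [lia|lia|right|left].
wlog cd : c d / (c <= d)%N.
  move=> W H; have [cd|dc] := leqP c d; first exact: W.
  by have [||[-> ->]|[-> ->]] := W d c; [lia|lia|right|left].
move=> H; left.
have aux m m' : (m < m')%N -> (2 * 2 ^ m <= 2 ^ m')%N by rewrite -expnS leq_exp2l.
have h1 : (2 ^ a <= 2 ^ b)%N by rewrite leq_exp2l.
have h2 : (2 ^ c <= 2 ^ d)%N by rewrite leq_exp2l.
have pa : (0 < 2 ^ a)%N by rewrite expn_gt0.
have pc : (0 < 2 ^ c)%N by rewrite expn_gt0.
have E : b = d by have [/aux|/aux|//] := ltngtP b d; lia.
split=> //; move: H; rewrite E => /addIn /eqP; rewrite eqn_exp2l // => /eqP //.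
Qed.

Definition bigD y := exists j, level (2 ^ j)%N y.

(* For powers of a this is the Sidon property of the powers of two. *)
Lemma bigD_overlap h : h <> gone G -> exists c c', forall y,
  (bigD y \/ y = ainf) -> (bigD (ay h y) \/ ay h y = ainf) ->
  ~ (y = ainf /\ ay h y = ainf) -> level c y \/ level c' (ay h y).
Proof.
move=> h1; have [[t E]|[s [t [u [l [E ln hl]]]]]] := axis_normal_form h; last first.
  (* Here h = a^t u a^s. If a^s y starts off the axis of a, then [y] leaves the axis exactly at
     level -s; otherwise [u] sends a^s y off the axis, and [ay h y] leaves it exactly at level t. *)
  exists (- s)%R, t => y Dy Dhy nn.
  have [sb|sb] := eqVneq (ay (apow s) y 0%N).1 i0; last first.
    left; rewrite /level opprK.
    case: Dy => [[j ly]|yE]; last by move: sb; rewrite yE ay_apow_ainf eqxx.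
    have [E2|N] := eqVneq ((2 ^ j)%N : int) (- s)%R.
      by move: ly; rewrite /level E2 opprK.
    exfalso; move: sb.
    have t0 : ((2 ^ j)%N%:Z + s != 0)%R by rewrite addr_eq0.
    have := @ay_apow_axis (ay (apow (- (2 ^ j)%N%:Z)) y) _ t0.
    rewrite ly -ayM -apowD (_ : (2 ^ j)%N%:Z + s + - (2 ^ j)%N%:Z = s)%R; last lia.
    by move=> ->; rewrite ?eqxx.
  right.
  have H : ay (apow (- t)) (ay h y) 0%N = l.
    by rewrite E !ayM -ayM -apowD addNr ay1 hl.
  case: Dhy => [[j lhy]|hyE]; last first.
    by move: H ln; rewrite hyE ay_apow_ainf => <-; rewrite eqxx.
  have [<-//|N] := eqVneq ((2 ^ j)%N : int) t.
  have t0 : (t - (2 ^ j)%N%:Z != 0)%R by rewrite subr_eq0 eq_sym.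
  have := @ay_apow_axis (ay (apow (- t)) (ay h y)) _ t0.
  rewrite H -ayM -apowD (_ : t - (2 ^ j)%N%:Z + - t = - (2 ^ j)%N%:Z)%R; last lia.
  by rewrite lhy => /(_ ln).
have t0 : (t != 0)%R by apply: contra_notN h1 => /eqP t0; rewrite E t0.
have D y : (bigD y \/ y = ainf) -> (bigD (ay h y) \/ ay h y = ainf) ->
    ~ (y = ainf /\ ay h y = ainf) ->
    exists i j : nat, level (2 ^ i)%N y /\ ((2 ^ j)%N%:Z = (2 ^ i)%N%:Z + t)%R.
  case=> [[i ly]|yE]; last first.
    case=> [[j lj]|hE] nn; last by case: nn.
    by move: lj; rewrite yE E ay_apow_ainf => /level_ainf.
  case=> [[j lhy]|hE] _; last first.
    case: (@level_ainf ((2 ^ i)%N%:Z + t)%R).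
    by rewrite -hE E; exact: (level_apow _ _ _).1.
  exists i, j; split=> //; apply: level_uniq lhy _.
  by rewrite E; exact: (level_apow _ _ _).1.
have [[i [j Eij]]|no] := pselect (exists i j : nat, ((2 ^ j)%N%:Z = (2 ^ i)%N%:Z + t)%R).
  (* Any other solution of 2^j' = 2^i' + t has i' = i because t is nonzero, so 2^i is the only
     possible level of [y]. *)
  exists ((2 ^ i)%N%:Z)%R, 0%R => y h2 h3 h4; left.
  have [i' [j' [ly E']]] := D y h2 h3 h4.
  have S : (2 ^ j + 2 ^ i' = 2 ^ j' + 2 ^ i)%N by lia.
  have [[_ <-]//|[ji _]] := pow2_sum_inj S.
  by exfalso; move: t0; rewrite ji in Eij; lia.
by exists 0%R, 0%R => y h2 h3 h4; case: no; have [i [j []]] := D y h2 h3 h4; exists i, j.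
Qed.

Definition eventually_a y := exists N, forall i, (N <= i)%N -> y i = la.

Lemma ay_eventually_a g y : eventually_a y -> eventually_a (ay g y).
Proof.
elim/(gen_ind he): g y => [|l g IH] y; first by rewrite ay1.
move=> /IH[N HN]; rewrite ayM ay_gen; exists N.+1 => -[//|i] iN.
have [E|NE] := eqVneq (ay g y 0%N) (linv l).
  by rewrite rpush_shift // HN //; lia.
by rewrite rpush_cons // HN.
Qed.

Definition binf : ray n := const_ray lb.

Lemma binf_not_orbit g : ay g binf <> ainf.
Proof.
move=> E; have : eventually_a binf.
  by rewrite -(ayK he g binf) E; apply: ay_eventually_a; exists 0%N.
by case=> N /(_ N (leqnn _)) [].
Qed.

Lemma ay_binf : ay (gen e lb) binf = binf.
Proof.
apply: ray_eq => i; rewrite ay_gen rpush_cons; first by case: i.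
exact: (const_rayP lb 0).
Qed.

(** Reduces prefixes to one-letter cylinders of translates, the sets to which [letter_noncrossing]
    applies. Letter i + 1 becomes letter i once the first letter is removed; as that letter depends
    on the ray, all choices of [l] are listed. *)
Lemma prefix_translates m : exists r : seq G, forall y z,
  (forall g, g \in r -> ay g y 0%N = ay g z 0%N) -> yagree m y z.
Proof.
elim: m => [|m [r IH]]; first by exists [::].
exists (gone G :: [seq gmul g (gen e l) | g <- r, l <- enum {: letter n}]) => y z H.
have E0 : y 0%N = z 0%N by have := H (gone G); rewrite mem_head !ay1; exact.
have sh (x : ray n) i : ay (gen e (linv (x 0%N))) x i = x i.+1.
  by rewrite ay_gen rpush_shift // linvK.
have {}IH := IH (ay (gen e (linv (y 0%N))) y) (ay (gen e (linv (y 0%N))) z).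
case=> [//|i] im; rewrite -!sh -E0; apply: IH => // g gr.
rewrite -!ayM; apply: H; rewrite inE; apply/orP; right.
by apply/allpairsP; exists (g, linv (y 0%N)); split=> //=; rewrite mem_enum.
Qed.

End Axis.

(** * Spaces presented by countably many clopen coordinates *)

Definition agree (T : Type) (I : countType) (p : I -> T -> bool) (N : nat)
    (x z : T) :=
  forall i, (pickle i < N)%N -> p i x = p i z.

(** An alias of [T] whose parameters carry its structure: neighbourhoods come from agreement on
    finitely many coordinates [p], and [x0] is the distinguished point. *)
Definition cspace (R : realType) (T : Type) (I : countType)
  (p : I -> T -> bool) (x0 : T) : Type := T.

Section CSpace.
Local Open Scope ring_scope.
Variables (R : realType) (T : Type) (I : countType) (p : I -> T -> bool).
Variable x0 : T.
Local Notation X := (cspace R p x0).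

HB.instance Definition _ := gen_eqMixin X.
HB.instance Definition _ := gen_choiceMixin X.
HB.instance Definition _ := isPointed.Build X x0.

Definition cspace_nbhs (x : X) : set_system X :=
  [set A | exists N, forall z, agree p N x z -> A z].

HB.instance Definition _ := hasNbhs.Build X cspace_nbhs.

(** Open ball for the pseudo-ultrametric given by the largest 1/(pickle i + 1) over the coordinates
    [i] where the points differ. *)
Definition cspace_ball (x : X) (e : R) (z : X) : Prop :=
  0 < e /\ forall i, e * (pickle i).+1%:R <= 1 -> p i x = p i z.

Let ball_center x (e : R) : 0 < e -> cspace_ball x e x.
Proof. by []. Qed.

Let ball_sym x z (e : R) : cspace_ball x e z -> cspace_ball z e x.
Proof. by move=> [e0 H]; split=> // i /H ->. Qed.

Let ball_triangle x y z (e1 e2 : R) :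
  cspace_ball x e1 y -> cspace_ball y e2 z -> cspace_ball x (e1 + e2) z.
Proof.
move=> [e10 H1] [e20 H2]; split=> [|i h]; first exact: addr_gt0.
have q0 : 0 < (pickle i).+1%:R :> R by [].
by rewrite H1 ?H2 //; apply: le_trans h; rewrite ler_pM2r // ?lerDl ?lerDr ltW.
Qed.

Let nbhsE : @nbhs _ X = nbhs_ (entourage_ cspace_ball).
Proof.
apply/funext => x; apply/seteqP; split => A.
  case=> N HN; exists [set xy | cspace_ball xy.1 N.+1%:R^-1 xy.2].
    by exists N.+1%:R^-1 => //=.
  move=> z /xsectionP /= [_ H]; apply: HN => i iN; apply: H.
  by rewrite mulrC ler_pdivrMr // mul1r ler_nat; lia.
case=> B [e /= e0 eB] BA.
exists (Num.truncn e^-1).+1 => z H; apply: BA; apply/xsectionP.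
apply: eB => /=; split=> // i h; apply: H.
apply: ltnW; rewrite -(@ltr_nat R).
apply: le_lt_trans (truncnS_gt _).
by rewrite -[e^-1]mul1r ler_pdivlMr // mulrC.
Qed.

HB.instance Definition _ :=
  @Nbhs_isPseudoMetric.Build R X (entourage_ cspace_ball) nbhsE cspace_ball
    ball_center ball_sym ball_triangle erefl.

Lemma cspace_nbhsP (x : X) (A : set X) :
  nbhs x A <-> exists N, forall z, agree p N x z -> A z.
Proof. by []. Qed.

Lemma agreeW (N M : nat) (x z : T) :
  (N <= M)%N -> agree p M x z -> agree p N x z.
Proof. by move=> NM H i iN; apply: H; apply: leq_trans NM. Qed.

Lemma agree_trans N (x y z : T) : agree p N x y -> agree p N y z -> agree p N x z.
Proof. by move=> H1 H2 i iN; rewrite H1 ?H2. Qed.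

Lemma agree_nbhs N (x : X) : nbhs x [set z | agree p N x z].
Proof. by exists N. Qed.

Lemma cspace_openP (A : set X) :
  open A <-> forall x, A x -> exists N, forall z, agree p N x z -> A z.
Proof. by rewrite openE; split => H x /H. Qed.

Lemma coord_open (i : I) (b : bool) : open [set x : X | p i x = b].
Proof.
by apply/cspace_openP => x xb; exists (pickle i).+1 => z H /=; rewrite -H ?ltnSn.
Qed.

Lemma cspace_hausdorff :
  (forall x z : T, (forall i, p i x = p i z) -> x = z) -> hausdorff_space X.
Proof.
move=> inj x z xz; apply: inj => i.
have [y [/= H1 H2]] := xz _ _ (agree_nbhs (pickle i).+1 x)
  (agree_nbhs (pickle i).+1 z).
by rewrite H1 ?H2 ?ltnSn.
Qed.

(** The hypothesis says that the image of [T] in the Cantor cube is closed. An ultrafilter decides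
    each coordinate, and a point with the decided coordinates is its limit. *)
Lemma cspace_compact :
  (forall c : I -> bool,
    (forall N, exists x, forall i, (pickle i < N)%N -> p i x = c i) ->
    exists x, forall i, p i x = c i) ->
  compact [set: X].
Proof.
move=> cl; rewrite compact_ultra => F UF _.
have /choice[c Fc] : forall i, exists b, F [set x | p i x = b].
  move=> i; have [|] := in_ultra_setVsetC [set x | p i x = true] UF.
    by exists true.
  move=> H; exists false; apply: filterS H => x /=.
  by case: (p i x).
have FN N : F [set x | forall i, (pickle i < N)%N -> p i x = c i].
  elim: N => [|N IH]; first exact: filterS filterT.
  case E : (unpickle N : option I) => [j|].
    apply: filterS (filterI IH (Fc j)) => x [H1 H2] i.
    rewrite ltnS leq_eqVlt => /orP[/eqP iN|/H1//].
    by move: E; rewrite -iN pickleK => -[->].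
  apply: filterS IH => x H1 i.
  rewrite ltnS leq_eqVlt => /orP[/eqP iN|/H1//].
  by move: E; rewrite -iN pickleK.
have [|x xc] := cl c.
  by move=> N; have /filter_ex[x] := FN N; exists x.
exists x; split=> // A [N NA].
by apply: filterS (FN N) => z H; apply: NA => i iN; rewrite xc H.
Qed.

Lemma cspace_lebesgue (W : X -> set X) : compact [set: X] ->
  (forall x, nbhs x (W x)) ->
  exists N, forall x, exists y, forall z, agree p N x z -> W y z.
Proof.
move=> /compact_near_coveringP cX nW.
have [x _|N _ H] := cX nat \oo
    (fun N x => exists y, forall z, agree p N x z -> W y z) _.
  have [N HN] := nW x.
  exists ([set z | agree p N x z], [set M | (N <= M)%N]) => /=.
    by split; [exact: agree_nbhs|exists N].
  move=> [z M] /= [xz NM]; exists x => u zu; apply: HN.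
  by apply: agree_trans xz _; apply: agreeW zu.
by exists N => x; apply: (H N) => /=.
Qed.

Lemma cspace_cvg (Z : Type) (F : set_system Z) (f : Z -> X) (x : X) : Filter F ->
  (forall i, \forall z \near F, p i (f z) = p i x) -> f @ F --> x.
Proof.
move=> FF H A [N NA]; suff HN : \forall z \near F, agree p N x (f z).
  by apply: (@filterS _ F) HN => z; apply: NA.
elim: N {NA} => [|N IH]; first exact: filterS filterT.
case E : (unpickle N : option I) => [j|].
  apply: filterS (filterI IH (H j)) => z [H1 H2] i.
  rewrite ltnS leq_eqVlt => /orP[/eqP iN|/H1//].
  by move: E; rewrite -iN pickleK => -[->]; rewrite H2.
apply: filterS IH => z H1 i.
rewrite ltnS leq_eqVlt => /orP[/eqP iN|/H1//].
by move: E; rewrite -iN pickleK.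
Qed.

Lemma cspace_continuous (Z : topologicalType) (f : Z -> X) :
  (forall x i, \forall z \near x, p i (f z) = p i (f x)) -> continuous f.
Proof. by move=> H x; apply: cspace_cvg => i; exact: H. Qed.

End CSpace.

Definition cyl (T : Type) (I : countType) (p : I -> T -> bool)
    (l : seq (I * bool)) : set T :=
  [set x | all (fun ib => p ib.1 x == ib.2) l].

(** * Borel probabilities on such spaces *)

Section CSpaceBorel.
Variables (R : realType) (T : Type) (I : countType) (p : I -> T -> bool).
Variable x0 : T.
Local Notation X := (cspace R p x0).

Lemma cyl_nil : cyl p [::] = setT.
Proof. by apply/seteqP; split. Qed.

Lemma cyl_open (l : seq (I * bool)) : open (cyl p l : set X).
Proof.
elim: l => [|[i b] l IH]; first by rewrite cyl_nil; exact: openT.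
rewrite (_ : cyl p _ = [set x : X | p i x = b] `&` cyl p l).
  by apply: openI => //; exact: coord_open.
by apply/seteqP; split=> x /= => [/andP[/eqP]|[? ?]] //; apply/andP; split=> //; apply/eqP.
Qed.

Lemma cyl_cat (l1 l2 : seq (I * bool)) : cyl p (l1 ++ l2) = cyl p l1 `&` cyl p l2.
Proof.
apply/seteqP; split=> x; rewrite /cyl /= all_cat; first by move/andP.
by case=> -> ->.
Qed.

Lemma cyl_agree N (x : T) : exists l, cyl p l x /\ cyl p l `<=` [set z | agree p N x z].
Proof.
exists [seq (i, p i x) | i <- pmap (unpickle : nat -> option I) (iota 0 N)].
split; first by rewrite /cyl /= all_map; apply/allP => i _ /=.
move=> z /=; rewrite /cyl /= all_map.
move=> /allP H i iN; apply/eqP; rewrite eq_sym; apply: H.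
by rewrite mem_pmap; apply/mapP; exists (pickle i); rewrite ?pickleK ?mem_iota.
Qed.

Lemma open_bigcup_cyl (A : set X) : open A -> exists F : nat -> set X,
  A = \bigcup_n F n /\ forall n, F n = set0 \/ exists2 l, F n = cyl p l & F n `<=` A.
Proof.
move=> /cspace_openP oA; exists (fun n => if unpickle n is Some l then
  if `[< cyl p l `<=` A >] then cyl p l else set0 else set0); split; last first.
  move=> n; case: (unpickle n) => [l|]; last by left.
  by case: asboolP => H; [right; exists l|left].
apply/seteqP; split=> [x|x [n _]]; last first.
  by case: (unpickle n) => // l; case: asboolP => // H /H.
move=> /oA[N NA]; have [l [xl lN]] := cyl_agree N x.
exists (pickle l) => //; rewrite pickleK.
by have -> : `[< cyl p l `<=` A >] by apply/asboolP => z /lN /NA.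
Qed.

Lemma cyl_measurable (l : seq (I * bool)) : measurable (cyl p l : set (borel X)).
Proof. by apply: sub_sigma_algebra; exact: cyl_open. Qed.

Lemma open_measurable_cspace (A : set X) : open A -> measurable (A : set (borel X)).
Proof. by move=> oA; apply: sub_sigma_algebra. Qed.

Lemma cspace_measurable_fun d (Z : measurableType d) (f : Z -> borel X) :
  (forall i, measurable [set z | p i (f z)]) -> measurable_fun setT f.
Proof.
move=> H; apply: measurability; first by rewrite /measurable/=.
move=> _ [A oA <-]; rewrite setTI.
have [F [-> HF]] := open_bigcup_cyl oA; rewrite preimage_bigcup.
apply: bigcupT_measurable => n; case: (HF n) => [->|[l -> _]].
  by rewrite preimage_set0.
elim: l => [|[i b] l IH]; first by rewrite cyl_nil preimage_setT.
rewrite (_ : _ @^-1` _ = [set z | p i (f z) = b] `&` f @^-1` cyl p l).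
  apply: measurableI => //; case: b; first exact: H.
  rewrite (_ : [set _ | _] = ~` [set z | p i (f z)]); first exact: measurableC.
  by apply/seteqP; split=> z /=; case: (p i _).
by apply/seteqP; split=> x /= => [/andP[/eqP]|[? ?]] //; apply/andP; split=> //; apply/eqP.
Qed.

Lemma prob_eq_cyl (m1 m2 : prob R X) :
  (forall l, m1 (cyl p l) = m2 (cyl p l)) ->
  forall A : set (borel X), measurable A -> m1 A = m2 A.
Proof.
move=> H A mA.
pose Gs : set (set (borel X)) := [set C | exists l, C = cyl p l].
have trE : [set C : set (borel X) | Gs C /\ C `<=` setT] = Gs.
  by apply/seteqP; split=> [C []|].
have := @g_sigma_algebra_measure_unique_trace _ R (borel X) Gs setT measurableT.
rewrite trE; apply => //.
- by move=> _ [l ->]; exact: cyl_measurable.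
- by move=> _ _ [l1 ->] [l2 ->]; exists (l1 ++ l2); rewrite cyl_cat.
- exact: etrans (probability_setT _) (esym (probability_setT _)).
- by move=> _ [l ->]; exact: H.
- apply: (@le_lt_trans _ _ 1%E); [exact: probability_le1|exact: ltry].
move: A mA; apply: smallest_sub; first exact: smallest_sigma_algebra.
move=> B oB; have [F [-> HF]] := open_bigcup_cyl oB.
apply: sigma_algebra_bigcup => n; case: (HF n) => [->|[l -> _]].
  exact: sigma_algebra0.
by apply: sub_sigma_algebra; exists l.
Qed.
(** Each null neighbourhood contains a null cylinder, and there are only countably many cylinders.
    This turns the support condition of a RIM into concentration on the fiber. *)
Lemma prob_null_cover (mu : prob R X) (A : set (borel X)) :
  measurable A ->
  (forall x, A x -> exists U : set X, [/\ open U, U x & mu U = 0%E]) ->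
  mu A = 0%E.
Proof.
move=> mA HA.
pose F n : set (borel X) := if unpickle n is Some l then
  if `[< mu (cyl p l) = 0%E >] then cyl p l else set0 else set0.
apply: measure_negligible => //; apply: (@negligibleS _ _ _ _ (\bigcup_n F n)).
  move=> x /HA[U [/cspace_openP oU /oU[N NU] U0]].
  have [l [xl lN]] := cyl_agree N x.
  exists (pickle l) => //; rewrite /F pickleK.
  suff -> : `[< mu (cyl p l) = 0%E >] by [].
  apply/asboolP; apply/eqP; rewrite -measure_le0 -U0; apply: le_measure.
  - by rewrite inE; exact: cyl_measurable.
  - by rewrite inE; apply: open_measurable_cspace; apply/cspace_openP.
  - by move=> z /lN /NU.
apply: negligible_bigcup => k; exists (F k); split=> //.
  by rewrite /F; case: unpickle => // l; case: asboolP => // _; exact: cyl_measurable.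
by rewrite /F; case: unpickle => [l|]; [case: asboolP => // _|]; rewrite measure0.
Qed.

End CSpaceBorel.

(** * The blow-up of the skew product *)

Section BlowUp.
Variables (R : realType) (G : group) (n : nat) (e : 'I_n -> G).
Hypotheses (hn : (2 <= n)%N) (he : free_basis e).
Implicit Types (l : letter n) (y z : ray n) (g h : G) (w : seq (letter n)).
Implicit Types k : nat -> bool.
Local Notation ay := (ay he).
Local Notation ak := (ak he).
Local Notation la := (la hn).
Local Notation lb := (lb hn).
Local Notation ainf := (ainf hn).
Local Notation level := (level hn he).

(* The orbit of [(ainf, k0)] is doubled; [xs] selects the sheet. *)
Record xpt := Xpt {
  xy : ray n;
  xk : nat -> bool;
  xs : bool;
  xP : xs -> exists g, ay g xy = ainf /\ ak g xk = k0 }.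

Implicit Types x : xpt.

Lemma xpt_eq x x' : xy x = xy x' -> xk x = xk x' -> xs x = xs x' -> x = x'.
Proof.
case: x x' => [y k s P] [y' k' s' P'] /= E1 E2 E3; subst.
by congr Xpt; exact: Prop_irrelevance.
Qed.

Lemma xact_subproof g x : xs x ->
  exists h, ay h (ay g (xy x)) = ainf /\ ak h (ak g (xk x)) = k0.
Proof.
move=> /xP[h [h1 h2]]; exists (gmul h (ginv g)).
by rewrite ayM ayK akM akK.
Qed.

Definition xact g x : xpt := Xpt (@xact_subproof g x).

Lemma xact1 x : xact (gone G) x = x.
Proof. by apply: xpt_eq => //=; rewrite ?ay1 ?ak1. Qed.

Lemma xactM g h x : xact (gmul g h) x = xact g (xact h x).
Proof. by apply: xpt_eq => //=; rewrite ?ayM ?akM. Qed.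

Lemma xplus_subproof y k : false -> exists g, ay g y = ainf /\ ak g k = k0.
Proof. by []. Qed.

Definition xplus y k : xpt := Xpt (@xplus_subproof y k).

Lemma xact_plus g y k : xact g (xplus y k) = xplus (ay g y) (ak g k).
Proof. exact: xpt_eq. Qed.

Definition singular x := xy x = ainf /\ xk x = k0.

(** The lift of E to X: divisibility of k by 2^j is agreement with [k0] on [j] bits, and exactly one
    copy of the base point is added. *)
Definition Et x : Prop :=
  (exists j : nat, level (2 ^ j)%N (xy x) /\ bagree j (xk x) k0) \/
  (singular x /\ xs x).

Lemma Et_singular x : singular x -> Et x <-> xs x.
Proof.
move=> sx; split=> [[[j []]|[]//]|]; last by right.
by case: sx => -> _ /level_ainf.
Qed.

Lemma level_first c j y : (forall i, (i < c)%N -> y i = la) -> y c <> la ->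
  level j%:Z%R y <-> j = c /\ y c = lb.
Proof.
move=> h1 h2; rewrite level_nat; split=> [[g1 g2]|[-> ->]] //.
have E : j = c.
  have [jc|cj|//] := ltngtP j c; first by move: g2; rewrite h1.
  by case: h2; apply: g1.
by rewrite -E.
Qed.

Lemma ray_first y : y <> ainf ->
  exists c, (forall i, (i < c)%N -> y i = la) /\ y c <> la.
Proof.
move=> /ray_neqP[j /eqP hj]; have ex : exists j, y j != la by exists j.
case: (ex_minnP ex) => c /eqP hc mc; exists c; split=> // i ic.
by apply/eqP; apply/negPn/negP => /mc; lia.
Qed.

(** Away from the base point E is clopen for the product topology. If y leaves a^oo at place c, only
    2^j = c matters, and c + 1 letters and bits decide. If y = a^oo, some bit v of k is set:
    divisibility by 2^j forces j <= v, and then level 2^j is excluded by the first 2^v + 1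
    letters. *)
Lemma Et_local x : ~ singular x -> exists m, forall x',
  yagree m (xy x) (xy x') -> bagree m (xk x) (xk x') -> Et x <-> Et x'.
Proof.
have [E|N] := pselect (xy x = ainf); last first.
  move=> _; have [c [c1 c2]] := ray_first N; exists c.+1 => x' Hy Hk.
  have c1' i : (i < c)%N -> xy x' i = la by move=> ic; rewrite -Hy ?c1 //; lia.
  have Ec : xy x' c = xy x c by rewrite Hy.
  have N' : xy x' <> ainf by move=> E; apply: c2; rewrite -Ec E.
  have aux x1 : (forall i, (i < c)%N -> xy x1 i = la) -> xy x1 c <> la ->
     xy x1 <> ainf -> Et x1 <-> exists j, [/\ (2 ^ j)%N = c, xy x1 c = lb & bagree j (xk x1) k0].
    move=> f1 f2 f3; split=> [[[j [/(level_first _ f1 f2)[]]]|[[]//]]|[j [g1 g2 g3]]].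
      by exists j.
    by left; exists j; split=> //; apply/(level_first _ f1 f2).
  rewrite (aux x) // (aux x') // ?Ec //.
  have jc j : (2 ^ j)%N = c -> (j <= c.+1)%N.
    by move=> <-; apply: leqW; apply: ltnW; apply: ltn_expl.
  by split=> -[j [g1 g2 g3]]; exists j; split=> // i ij; rewrite -(g3 i ij) ?Hk //;
    apply: leq_trans ij _; exact: jc.
move=> sx; have [v kv] : exists v, xk x v.
  apply: contrapT => H; apply: sx; split=> //; apply/funext => i.
  by apply/negbTE/negP => ki; apply: H; exists i.
exists (2 ^ v).+1 => x' Hy Hk.
have vl : (v < (2 ^ v).+1)%N by apply: leqW; apply: ltn_expl.
have kv' : xk x' v by rewrite -Hk.
split=> [[[j []]|[[_ E0] _]]|[[j []]|[[_ E0] _]]].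
- by rewrite E => /level_ainf.
- by move: kv; rewrite E0.
- move=> /level_nat[l1 l2] /(_ v); rewrite kv'.
  have [jv|vj] := leqP j v; last by move=> /(_ isT).
  have : (2 ^ j <= 2 ^ v)%N by rewrite leq_exp2l.
  by rewrite -ltnS => /Hy; rewrite l2 E.
- by move: kv'; rewrite E0.
Qed.

(** Translates of E are indexed by words, which form a countable type; different words may name the
    same translate. *)
Definition xidx : Type := ((nat * letter n) + nat + seq (letter n))%type.
HB.instance Definition _ := Countable.on xidx.

Definition xcoord (i : xidx) x : bool :=
  match i with
  | inl (inl (i, l)) => xy x i == l
  | inl (inr i) => xk x i
  | inr w => `[< Et (xact (weval e w) x) >]
  end.

Definition ycoord (i : nat * letter n) y := y i.1 == i.2.
Definition kcoord (i : nat) (k : nat -> bool) := k i.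

Definition xbase : xpt := xplus ainf k0.

Definition Xs : pseudoPMetricType R := cspace R xcoord xbase.
Definition Ys : pseudoPMetricType R := cspace R ycoord ainf.
Definition Ks : pseudoPMetricType R := cspace R kcoord k0.

Lemma leq_bigmax2 (T : finType) m (F : nat -> T -> nat) i t : (i < m)%N ->
  (F i t <= \max_(i < m) \max_(t : T) F i t)%N.
Proof.
move=> im; apply: leq_trans (leq_bigmax (Ordinal im)) => /=; exact: leq_bigmax.
Qed.

Lemma ycoord_agree m : exists N, forall y z, agree ycoord N y z -> yagree m y z.
Proof.
exists (\max_(i < m) \max_(l : letter n) (pickle (i : nat, l)).+1) => y z H i im.
apply/esym/eqP; rewrite -[_ == _]/(ycoord (i, y i) z) -H ?/ycoord //=.
exact: (leq_bigmax2 (fun i l => (pickle (i, l)).+1)).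
Qed.

Lemma yagree_nbhs m (y : Ys) : \forall z \near y, yagree m y z.
Proof. by have [N HN] := ycoord_agree m; exists N => z; exact: HN. Qed.

Lemma bagree_nbhs m (k : Ks) : \forall k' \near k, bagree m k k'.
Proof.
by exists m => k' H i im; apply: (H i).
Qed.

Lemma near_agree_ord (Z : topologicalType) (x : Z) (P : nat -> Z -> Prop) m :
  (forall i, \forall z \near x, P i z) ->
  \forall z \near x, forall i, (i < m)%N -> P i z.
Proof.
move=> H; elim: m => [|m IH]; first exact: filterS filterT.
apply: filterS (filterI IH (H m)) => z [h1 h2] i.
by rewrite ltnS leq_eqVlt => /orP[/eqP->|/h1].
Qed.

Lemma xcoord_near (i : xidx) (x : Xs) : \forall z \near x, xcoord i z = xcoord i x.
Proof. by exists (pickle i).+1 => z H; rewrite (H i). Qed.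

Lemma xy_near m (x : Xs) : \forall z \near x, yagree m (xy x) (xy z).
Proof.
apply: near_agree_ord => i.
apply: filterS (xcoord_near (inl (inl (i, xy x i))) x) => z /=.
by rewrite eqxx => /eqP ->.
Qed.

Lemma xk_near m (x : Xs) : \forall z \near x, bagree m (xk x) (xk z).
Proof.
apply: near_agree_ord => i.
by apply: filterS (xcoord_near (inl (inr i)) x) => z /= ->.
Qed.

Lemma Et_near g (x : Xs) : \forall z \near x, Et (xact g x) <-> Et (xact g z).
Proof.
have [w <-] := weval_surj he g.
apply: filterS (xcoord_near (inr w) x) => z H.
by have [h1 h2] := asbool_eq_equiv H; split.
Qed.

Lemma xcontinuous (Z : topologicalType) (f : Z -> Xs) :
  (forall m (x : Z), \forall z \near x, yagree m (xy (f x)) (xy (f z))) ->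
  (forall m (x : Z), \forall z \near x, bagree m (xk (f x)) (xk (f z))) ->
  (forall g (x : Z), \forall z \near x, Et (xact g (f x)) <-> Et (xact g (f z))) ->
  continuous f.
Proof.
move=> H1 H2 H3; apply: cspace_continuous => x [[[i l]|i]|w].
- by apply: filterS (H1 i.+1 x) => z /= ->.
- by apply: filterS (H2 i.+1 x) => z /= ->.
- by apply: filterS (H3 (weval e w) x) => z [h1 h2] /=; apply: asbool_equiv_eq.
Qed.

Lemma xact_continuous g : continuous (xact g : Xs -> Xs).
Proof.
apply: xcontinuous => [m x|m x|h x].
- have [M HM] := ay_modulus he g m.
  by apply: filterS (xy_near M x) => z; exact: HM.
- by apply: filterS (xk_near m x) => z; exact: ak_agree.
- by apply: filterS (Et_near (gmul h g) x) => z; rewrite !xactM.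
Qed.

Lemma ay_continuous g : continuous (ay g : Ys -> Ys).
Proof.
apply: cspace_continuous => y [i l]; have [M HM] := ay_modulus he g i.+1.
by apply: filterS (yagree_nbhs M y) => z /HM H; rewrite /ycoord /= H.
Qed.

Lemma ak_continuous g : continuous (ak g : Ks -> Ks).
Proof.
apply: cspace_continuous => k i.
by apply: filterS (bagree_nbhs i.+1 k) => k' /(ak_agree he g) H; rewrite /kcoord H.
Qed.

Lemma xy_continuous : continuous (xy : Xs -> Ys).
Proof.
apply: cspace_continuous => x [i l].
by apply: filterS (xy_near i.+1 x) => z H; rewrite /ycoord /= H.
Qed.

Lemma xk_continuous : continuous (xk : Xs -> Ks).
Proof.
apply: cspace_continuous => x i.
by apply: filterS (xk_near i.+1 x) => z H; rewrite /kcoord /= H.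
Qed.

(* On a single fiber the level of [ay g y] is fixed, so Et only sees finitely
   many bits. *)
Lemma Et_fiber y g : exists m, forall k k', bagree m k k' ->
  Et (xact g (xplus y k)) <-> Et (xact g (xplus y k')).
Proof.
have [[j lj]|no] := pselect (exists j : nat, level (2 ^ j)%N (ay g y)); last first.
  exists 0%N => k k' _; split=> -[[j [lj _]]|[_ //]]; by case: no; exists j.
have jE j' : level (2 ^ j')%N (ay g y) -> j' = j.
  by move=> /(level_uniq lj) -[] /eqP; rewrite eqn_exp2l // => /eqP.
exists j => k k' /(ak_agree he g) H.
by split=> -[[j' [/[dup] lj' /jE E b]]|[_ //]]; left; exists j'; split=> // i ij;
  rewrite -(b i ij) /= H // -E.
Qed.

(** In each fiber the sheet [xs = false] is a copy of the odometer, because a translate of E cuts it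
    along finitely many bits. This includes the fiber over a^oo, where the other copy of the base
    point is isolated. *)
Lemma xplus_continuous y : continuous (xplus y : Ks -> Xs).
Proof.
apply: xcontinuous => [m k|m k|g k].
- by apply: filterS filterT.
- exact: bagree_nbhs.
- have [m Hm] := Et_fiber y g.
  by apply: filterS (bagree_nbhs m k) => k' /Hm.
Qed.

Lemma Ys_hausdorff : hausdorff_space Ys.
Proof.
apply: cspace_hausdorff => y z H; apply: ray_eq => i.
by have := H (i, y i); rewrite /ycoord /= eqxx => /esym/eqP.
Qed.

Lemma Xs_hausdorff : hausdorff_space Xs.
Proof.
apply: cspace_hausdorff => x z H.
have E1 : xy x = xy z.
  apply: ray_eq => i.
  by have := H (inl (inl (i, xy x i))); rewrite /= eqxx => /esym/eqP.
have E2 : xk x = xk z by apply/funext => i; exact: (H (inl (inr i))).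
apply: xpt_eq => //.
(* Two points that could differ only in the sheet are moved onto the base point, where E reads off
   the sheet. *)
have aux u v : xy u = xy v -> xk u = xk v ->
    (forall i, xcoord i u = xcoord i v) -> xs u -> xs v.
  move=> F1 F2 F us; have [g [g1 g2]] := xP us.
  have su : singular (xact g u) by [].
  have sv : singular (xact g v) by rewrite /singular /= -F1 -F2.
  have [w wg] := weval_surj he g.
  have := asbool_eq_equiv (F (inr w)); rewrite wg => -[h _].
  exact: (Et_singular sv).1 (h ((Et_singular su).2 us)).
by apply/idP/idP; apply: aux.
Qed.

Lemma ray_limit (c : nat -> letter n -> bool) :
  (forall m, exists y, forall i l, (i < m)%N -> (y i == l) = c i l) ->
  exists y, forall i l, (y i == l) = c i l.
Proof.
move=> H; have /choice[f Hf] : forall i, exists l, c i l.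
  by move=> i; have [y Hy] := H i.+1; exists (y i); rewrite -Hy // eqxx.
have Hu m y : (forall i l, (i < m)%N -> (y i == l) = c i l) ->
    forall i, (i < m)%N -> y i = f i.
  by move=> Hy i im; apply/eqP; rewrite Hy.
have fP i : f i.+1 != linv (f i).
  have [y Hy] := H i.+2.
  by rewrite -!(Hu _ _ Hy) ?rayP.
exists (Ray fP) => i l /=; have [y Hy] := H i.+1.
by rewrite -(Hu _ _ Hy) // Hy.
Qed.

Lemma Ys_compact : compact [set: Ys].
Proof.
apply: cspace_compact => c H.
have [m|y Hy] := @ray_limit (fun i l => c (i, l)).
  have [y Hy] := H (\max_(i < m) \max_(l : letter n) (pickle (i : nat, l)).+1).
  exists y => i l im; rewrite -Hy //.
  exact: (leq_bigmax2 (fun i l => (pickle (i, l)).+1)).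
by exists y => -[i l]; exact: Hy.
Qed.

Lemma Xs_compact : compact [set: Xs].
Proof.
apply: cspace_compact => c H.
(* Two word coordinates are matched at once, because two words for the same group element must
   receive the same limit value. *)
have Hm m w w' : exists x, [/\ forall i l, (i < m)%N -> (xy x i == l) = c (inl (inl (i, l))),
    forall i, (i < m)%N -> xk x i = c (inl (inr i)),
    xcoord (inr w) x = c (inr w) & xcoord (inr w') x = c (inr w')].
  pose N1 := \max_(i < m) \max_(l : letter n) (pickle (inl (inl (i : nat, l)) : xidx)).+1.
  pose N2 := \max_(i < m) (pickle (inl (inr (i : nat)) : xidx)).+1.
  pose N3 := maxn (pickle (inr w : xidx)).+1 (pickle (inr w' : xidx)).+1.
  have [x Hx] := H (maxn N1 (maxn N2 N3)); exists x.
  split=> [i l im|i im||]; rewrite -Hx // !leq_max.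
  - apply/orP; left.
    exact: (leq_bigmax2 (fun i l => (pickle (inl (inl (i, l)) : xidx)).+1)).
  - apply/orP; right; apply/orP; left.
    exact: (leq_bigmax (Ordinal im)).
  - by rewrite leqnn !orbT.
  - by rewrite leqnn !orbT.
have [m|y Hy] := @ray_limit (fun i l => c (inl (inl (i, l)))).
  by have [x [Hx _ _ _]] := Hm m [::] [::]; exists (xy x).
pose k i := c (inl (inr i)).
(* Where the translate of the limit is not the base point, E is locally constant in the product
   topology, so [y] and [k] determine the coordinate. *)
have reg x w : xy x = y -> xk x = k -> ~ singular (xact (weval e w) x) ->
    xcoord (inr w) x = c (inr w).
  move=> xE kE /Et_local[m Hl]; have [M HM] := ay_modulus he (weval e w) m.
  have [x' [h1 h2 <- _]] := Hm (maxn M m) w w.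
  apply: asbool_equiv_eq; apply: Hl => /=.
    apply: HM => i iM; apply/esym/eqP; rewrite h1 ?xE; last by rewrite leq_max iM.
    by rewrite -Hy.
  apply: ak_agree => i im; rewrite h2 ?kE //; by rewrite leq_max im orbT.
(* If the limit lies on the doubled orbit, the sheet is read off at the word [w0]; by freeness, any
   word reaching the base point names the same element as [w0]. *)
have [[w0 [a1 a2]]|no] := pselect (exists w, ay (weval e w) y = ainf /\ ak (weval e w) k = k0).
  have P : c (inr w0) -> exists g, ay g y = ainf /\ ak g k = k0.
    by move=> _; exists (weval e w0).
  exists (Xpt P) => -[[[i l]|i]|w] //; first exact: Hy.
  have [E|N] := pselect (singular (xact (weval e w) (Xpt P))); last exact: reg.
  have Ew : weval e w = weval e w0.
    case: E => /= b1 b2.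
    have : gmul (weval e w) (ginv (weval e w0)) = gone G.
      apply: (@orbit_free _ _ _ hn he _ k0); rewrite ?ayM ?akM.
        by rewrite -{1}a1 ayK.
      by rewrite -{1}a2 akK.
    by move=> /ginv_unique; rewrite ginvK.
  transitivity (c (inr w0)).
    by apply/asboolP/idP => [/(Et_singular E)|/(Et_singular E)].
  have [x [_ _ <- <-]] := Hm 0%N w w0; by rewrite /= Ew.
exists (xplus y k) => -[[[i l]|i]|w] //; first exact: Hy.
apply: reg => // -[b1 b2]; apply: no; by exists w.
Qed.

End BlowUp.

(** * Minimality, distality, and failure of openness *)

Section Dynamics.
Variables (R : realType) (G : group) (n : nat) (e : 'I_n -> G).
Hypotheses (hn : (2 <= n)%N) (he : free_basis e).
Implicit Types (l : letter n) (y z : ray n) (g h : G).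
Implicit Types k : nat -> bool.
Local Notation ay := (ay he).
Local Notation ak := (ak he).
Local Notation la := (la hn).
Local Notation lb := (lb hn).
Local Notation ainf := (ainf hn).
Local Notation binf := (binf hn).
Local Notation level := (level hn he).
Local Notation xpt := (xpt hn he).
Local Notation Xs := (Xs R hn he).
Local Notation Ys := (Ys R hn).
Implicit Types x : xpt.

(** The ray a^c b b b ... for [b = true], and a^c b^-1 b^-1 ... for [b = false]. With c = 2^j and k
    = 0 the first family lies in E and the second outside, so they approach the two copies of the
    base point. *)
Definition spur_fun (b : bool) c i : letter n :=
  if (i < c)%N then la else (i1 hn, b).

Lemma spur_funP b c i : spur_fun b c i.+1 != linv (spur_fun b c i).
Proof.
rewrite /spur_fun; case: ltnP => h; case: ltnP => h' //; try lia.
by apply/eqP => -[]; case: b.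
Qed.

Definition spur b c : ray n := Ray (spur_funP b c).

Lemma spur_not_eventually b c : ~ eventually_a hn (spur b c).
Proof.
case=> N /(_ (maxn N c) (leq_maxl _ _)).
by rewrite /= /spur_fun ltnNge leq_maxr /= => -[].
Qed.

Lemma level_spur b c (j : nat) : level j%:Z%R (spur b c) <-> j = c /\ b.
Proof.
rewrite (@level_first _ _ _ _ _ c); first 1 last.
- by move=> i ic; rewrite /= /spur_fun ic.
- by rewrite /= /spur_fun ltnn => -[].
rewrite /= /spur_fun ltnn; split=> -[-> h]; split=> //; first by case: h.
by rewrite h.
Qed.

Lemma yagree_agree N : exists M, forall y z, yagree M y z -> agree (@ycoord n) N y z.
Proof.
elim: N => [|N [M IH]]; first by exists 0%N.
case E : (unpickle N : option (nat * letter n)) => [[j l]|].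
  exists (maxn M j.+1) => y z H i; rewrite ltnS leq_eqVlt => /orP[/eqP iN|].
    by move: E; rewrite -iN pickleK => -[->]; rewrite /ycoord /= H // leq_maxr.
  by apply: IH; apply: yagreeW H; exact: leq_maxl.
exists M => y z H i; rewrite ltnS leq_eqVlt => /orP[/eqP iN|]; last exact: IH.
by move: E; rewrite -iN pickleK.
Qed.

Definition regular x := forall g, ~ singular (xact g x).

Lemma regular_not_eventually x : ~ eventually_a hn (xy x) -> regular x.
Proof.
move=> N g [E _]; apply: N; rewrite -(ayK he g (xy x)) -[ay g _]/(xy (xact g x)) E.
by apply: ay_eventually_a; exists 0%N.
Qed.

(** By freeness, E itself is the only translate that is not locally constant at [x], and the spur
    was chosen to lie in E exactly when the sheet of [x] does. *)
Lemma spur_cvg x : singular x ->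
  ((fun j => xplus hn he (spur (xs x) (2 ^ j)) k0) : nat -> Xs) @ \oo --> (x : Xs).
Proof.
move=> sx; have [xE kE] := sx.
have ag M : \forall j \near \oo, yagree M (xy x) (spur (xs x) (2 ^ j)).
  exists M => // j /= Mj i iM; rewrite xE /= /spur_fun ifT //.
  by apply: leq_trans iM _; apply: leq_trans Mj _; apply: ltnW; apply: ltn_expl.
apply: cspace_cvg => -[[[i l]|i]|w].
- by apply: filterS (ag i.+1) => j /= ->.
- by apply: nearW => j /=; rewrite kE.
have [sw|nsw] := pselect (singular (xact (weval e w) x)).
  have Ew : weval e w = gone G.
    by apply: (@orbit_free _ _ _ hn he _ k0); [rewrite -{1}xE; case: sw|rewrite -{1}kE; case: sw].
  apply: nearW => j /=; rewrite Ew !xact1; apply: asbool_equiv_eq.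
  apply: iff_trans (iff_sym (Et_singular sx)); split=> [[[i [/level_spur[_]]]|[]]|] //= sxs.
  by left; exists j; split=> //; apply/level_spur.
have [m Hm] := Et_local nsw; have [M HM] := ay_modulus he (weval e w) m.
apply: filterS (ag M) => j /HM Hj /=; apply: asbool_equiv_eq; apply: iff_sym.
by apply: Hm => //=; rewrite kE.
Qed.

Lemma regular_dense (x : Xs) (N : set Xs) : nbhs x N -> exists2 x1, N x1 & regular x1.
Proof.
move=> Nx; have [rx|] := pselect (regular x); first by exists x => //; exact: nbhs_singleton.
move=> /existsNP[g /contrapT sg].
have Nx' : nbhs (xact g x : Xs) (xact (ginv g) @^-1` N : set Xs).
  apply: (@xact_continuous R _ _ _ hn he (ginv g) (xact g x)).
  by rewrite -xactM gmulVg xact1.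
have [j Nj] : exists j, N (xact (ginv g) (xplus hn he (spur (xs (xact g x)) (2 ^ j)) k0)).
  by have [J _ HJ] := spur_cvg sg Nx'; exists J; exact: (HJ J (leqnn J)).
exists (xact (ginv g) (xplus hn he (spur (xs (xact g x)) (2 ^ j)) k0)) => // h.
by rewrite -xactM; apply: regular_not_eventually; exact: spur_not_eventually.
Qed.

Lemma regular_box (x : Xs) (N : set Xs) : regular x -> nbhs x N ->
  exists m, forall x', yagree m (xy x) (xy x') -> bagree m (xk x) (xk x') -> N x'.
Proof.
move=> rx Nx.
pose F : set_system xpt := [set A | exists m, forall x',
  yagree m (xy x) (xy x') -> bagree m (xk x) (xk x') -> A x'].
have FF : Filter F.
  split=> [|A B [m1 H1] [m2 H2]|A B AB [m H]]; first by exists 0%N.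
    exists (maxn m1 m2) => x' hy hk; split; [apply: H1|apply: H2].
    - by apply: yagreeW hy; exact: leq_maxl.
    - by apply: bagreeW hk; exact: leq_maxl.
    - by apply: yagreeW hy; exact: leq_maxr.
    - by apply: bagreeW hk; exact: leq_maxr.
  by exists m => x' hy hk; apply: AB; apply: H.
suff Fx : (id : xpt -> Xs) @ F --> x by exact: Fx Nx.
apply: cspace_cvg => -[[[i l]|i]|w].
- by exists i.+1 => x' /= ->.
- by exists i.+1 => x' _ /= ->.
have [m Hm] := Et_local (rx (weval e w)); have [M HM] := ay_modulus he (weval e w) m.
exists (maxn M m) => x' hy hk; apply: asbool_equiv_eq; apply: iff_sym; apply: Hm.
  by apply: HM; apply: yagreeW hy; exact: leq_maxl.
by apply: ak_agree; apply: bagreeW hk; exact: leq_maxr.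
Qed.

(** Regular points are dense, and at them the topology is that of the product, where [orbit_dense]
    applies. *)
Lemma orbit_meets (x x' : Xs) (N : set Xs) : nbhs x' N -> exists g, N (xact g x).
Proof.
rewrite nbhsE => -[U [oU Ux'] UN].
have [x1 Ux1 r1] := regular_dense (open_nbhs_nbhs (conj oU Ux')).
have [m Hm] := regular_box r1 (open_nbhs_nbhs (conj oU Ux1)).
have [g [g1 g2]] := orbit_dense he hn (xy x) (xk x) (xy x1) (xk x1) m.
by exists g; apply: UN; apply: Hm => i im; [rewrite /= g1|rewrite /= g2].
Qed.

Lemma xact_minimal : minimal_action (xact (hn := hn) (he := he) : G -> Xs -> Xs).
Proof.
move=> A cA [x Ax] iA; apply/seteqP; split=> // x' _; apply: cA => N /(orbit_meets x)[g Ng].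
by exists (xact g x); split=> //; apply: (iA g); exists x.
Qed.

(** The fiber over b^oo contains no doubled point, so it is the odometer, on which the group acts by
    isometries: a bit where two points differ keeps all their images apart. *)
Lemma xy_point_distal :
  point_distal (xact (hn := hn) (he := he) : G -> Xs -> Xs) (xy (he := he) : Xs -> Ys).
Proof.
exists (xplus hn he binf k0 : Xs); split.
  apply/seteqP; split=> // x' _ N /(orbit_meets (xplus hn he binf k0))[g Ng].
  by exists (xact g (xplus hn he binf k0)); split=> //; exists g.
move=> x' nx /= xE [z cz].
have ns : xs x' = false.
  by apply/negP => /xP[g []]; rewrite xE => /binf_not_orbit.
have [v kv] : exists v, xk x' v.
  apply: contrapT => H; apply: nx; apply: xpt_eq => //=; apply/funext => i.
  by apply/negbTE/negP => ki; apply: H; exists i.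
have nz : nbhs (z : Xs) [set u : Xs | bagree v.+1 (xk z) (xk u)] by exact: xk_near.
have [_ [[g _ <-] /= [h1 h2]]] := cz _ (ex_intro2 _ _ (_, _) (conj nz nz) (@subset_refl _ _)).
have : bagree v.+1 (ak g k0) (ak g (xk x')) by move=> i iv; rewrite -h1 // h2.
by move=> /(ak_agree he (ginv g)) /(_ v (ltnSn v)); rewrite !akK kv.
Qed.

Lemma xminus_subproof : true -> exists g, ay g ainf = ainf /\ ak g k0 = k0.
Proof. by move=> _; exists (gone G); rewrite ay1 ak1. Qed.

Definition xminus : xpt := Xpt xminus_subproof.

Lemma xy_not_open : ~ open_map (xy (he := he) : Xs -> Ys).
Proof.
move=> /(_ [set x | Et x]) op.
have oE : open ([set x | Et x] : set Xs).
  rewrite openE => x Ex; rewrite /interior /=.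
  by apply: filterS (@Et_near R _ _ _ hn he (gone G) x) => z; rewrite !xact1 => -[+ _]; exact.
have /cspace_openP/(_ ainf)[] := op oE.
  by exists xminus => //=; right.
move=> N HN.
have [M HM] := yagree_agree N.
have [|x Ex /= xE] := HN (spur false M).
  by apply: HM => i iM; rewrite /= /spur_fun iM.
case: Ex => [[j [+ _]]|[[+ _] _]]; rewrite xE; first by move/level_spur => [].
by move=> E; apply: (@spur_not_eventually false M); rewrite E; exists 0%N.
Qed.

End Dynamics.

(** * Counting atoms *)

Definition few_classes (T : Type) (E : T -> T -> Prop) (M : nat) :=
  exists c : T -> nat, (forall x, (c x < M)%N) /\ forall x x', c x = c x' -> E x x'.

Section Counting.
Variable T : Type.

(* Adding a set to a family it does not cross splits at most one atom. *)
Lemma noncrossing_classes (J : eqType) (P : J -> T -> bool) (r : seq J) :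
  (forall j j', exists b b', forall x, ~ (P j x = b /\ P j' x = b')) ->
  exists c : T -> nat, (forall x, (c x <= size r)%N) /\
    forall x x', c x = c x' <-> forall j, j \in r -> P j x = P j x'.
Proof.
move=> nc; elim: r => [|j r [c [c1 c2]]]; first by exists (fun=> 0%N); split.
have [[x1 [x2 [e12 d12]]]|ns] :=
    pselect (exists x1 x2, c x1 = c x2 /\ P j x1 <> P j x2); last first.
  exists c; split=> [x|x x']; first exact: leqW.
  split=> [E i|H].
    rewrite inE => /orP[/eqP->|ir]; last exact: (c2 x x').1.
    by apply: contrapT => N; apply: ns; exists x, x'.
  by apply/c2 => i ir; apply: H; rewrite inE ir orbT.
(* Only one atom is split: if [P j] took both values on two atoms separated by [P i], all four
   combinations of [P j] and [P i] would occur. *)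
have only x x' : c x = c x' -> P j x <> P j x' -> c x = c x1.
  move=> E d; apply: contrapT => N.
  have [i ir Pi] : exists2 i, i \in r & P i x <> P i x1.
    apply: contrapT => H; apply: N; apply/c2 => i ir.
    by apply: contrapT => Hi; apply: H; exists i.
  have F1 := (c2 x x').1 E i ir; have F2 := (c2 x1 x2).1 e12 i ir.
  have [b [b' nb]] := nc j i.
  have := (nb x, nb x', nb x1, nb x2).
  move: d d12 Pi; rewrite -F1 -F2.
  by case: (P j x); case: (P j x'); case: (P j x1); case: (P j x2); case: (P i x);
    case: (P i x1); case: b {nb}; case: b' => // _ _ _ [[[n1 n2] n3] n4];
    solve [by case: n1|by case: n2|by case: n3|by case: n4].
pose c' x := if (c x == c x1) && P j x then (size r).+1 else c x.
exists c'; split=> [x|x x']; first by rewrite /c'; case: ifP => // _; exact: leqW.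
rewrite /c'; split.
  case: ifP => [/andP[/eqP E1 p1]|n1]; case: ifP => [/andP[/eqP E2 p2]|n2].
  - move=> _ i; rewrite inE => /orP[/eqP->|ir]; first by rewrite p1 p2.
    by apply: (c2 x x').1 => //; rewrite E1.
  - by move=> E; have := c1 x'; rewrite -E ltnn.
  - by move=> E; have := c1 x; rewrite E ltnn.
  - move=> E i; rewrite inE => /orP[/eqP->|ir]; last exact: (c2 x x').1.
    apply: contrapT => N; have E1 := only _ _ E N.
    move: n1 n2 N; rewrite -E E1 eqxx /=.
    by move=> -> ->.
move=> H; have E : c x = c x' by apply/c2 => i ir; apply: H; rewrite inE ir orbT.
by rewrite E (H j) ?mem_head.
Qed.

Lemma few_and (E1 E2 : T -> T -> Prop) M1 M2 : few_classes E1 M1 ->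
  few_classes E2 M2 -> few_classes (fun x x' => E1 x x' /\ E2 x x') (M1 * M2).
Proof.
move=> [c [c1 c2]] [d [d1 d2]]; exists (fun x => (c x * M2 + d x)%N); split=> [x|x x' E].
  have := c1 x; have := d1 x; nia.
have dE : d x = d x'.
  by have := congr1 (modn^~ M2) E; rewrite !modnMDl !modn_small.
by split; [apply: c2|exact: d2]; move: (d1 x) E; rewrite dE; nia.
Qed.

Lemma few_sub (E1 E2 : T -> T -> Prop) M : few_classes E1 M ->
  (forall x x', E1 x x' -> E2 x x') -> few_classes E2 M.
Proof. by move=> [c [c1 c2]] H; exists c; split=> // x x' /c2 /H. Qed.

Lemma few_covnum (E : T -> T -> Prop) (I : Type) (V : I -> set T) M :
  few_classes E M -> (forall x, exists i, forall x', E x x' -> V i x') ->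
  (covnum V <= M)%N.
Proof.
move=> [c [c1 c2]] HV; rewrite /covnum; case: pselect => // h.
case: ex_minnP => q _ qmin.
have [[x0 _]|no] := pselect (exists x : T, True); last first.
  apply: leq_trans (qmin 0%N _) _ => //; apply/asboolP.
  have J : 'I_0 -> I by case.
  by exists J => x; case: no; exists x.
apply: qmin; apply/asboolP; have [i00 _] := HV x0.
have /choice[J HJ] : forall v : 'I_M, exists i, forall x, c x = v -> V i x.
  move=> v; have [[x xv]|no] := pselect (exists x, c x = v); last first.
    by exists i00 => x xv; case: no; exists x.
  by have [i Hi] := HV x; exists i => x' x'v; apply: Hi; apply: c2; rewrite xv x'v.
by exists J => x; exists (Ordinal (c1 x)); exact: HJ.
Qed.

End Counting.

(** * Polynomial bounds on the atoms of joins *)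

Section Null.
Variables (R : realType) (G : group) (n : nat) (e : 'I_n -> G).
Hypotheses (hn : (2 <= n)%N) (he : free_basis e).
Implicit Types (l : letter n) (y z : ray n) (g h : G).
Implicit Types k : nat -> bool.
Local Notation ay := (ay he).
Local Notation ak := (ak he).
Local Notation lb := (lb hn).
Local Notation ainf := (ainf hn).
Local Notation level := (level hn he).
Local Notation apow := (apow e hn).
Local Notation xpt := (xpt hn he).
Local Notation Xs := (Xs R hn he).
Implicit Types x : xpt.

Definition same_letters (r : seq G) x x' :=
  forall g, g \in r -> ay g (xy x) 0%N = ay g (xy x') 0%N.
Definition same_Et (r : seq G) x x' :=
  forall g, g \in r -> Et (xact g x) <-> Et (xact g x').

Lemma few_letters (r : seq G) :
  few_classes (same_letters r) (size r * #|{: letter n}|).+1.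
Proof.
pose P (j : G * letter n) x := ay j.1 (xy x) 0%N == j.2.
have [j j'|c [c1 c2]] := @noncrossing_classes xpt _ P
    [seq (g, l) | g <- r, l <- enum {: letter n}].
  have [b [b' nb]] := letter_noncrossing he j.1 j'.1 j.2 j'.2.
  by exists b, b' => x; exact: nb.
exists c; split=> [x|x x' /c2 H g gr].
  by rewrite ltnS; apply: leq_trans (c1 x) _; rewrite size_allpairs -cardE.
apply/esym/eqP; rewrite -[_ == _]/(P (g, ay g (xy x) 0%N) x') -H ?/P //=.
by apply/allpairsP; exists (g, ay g (xy x) 0%N); split=> //=; rewrite mem_enum.
Qed.

Lemma few_bits M : few_classes (fun x x' => bagree M (xk x) (xk x')) (2 ^ M).
Proof.
exists (fun x => bval (xk x) M); split=> [x|x x']; first exact: bval_lt.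
exact: bval_inj.
Qed.

Lemma Et_level x : Et x -> bigD hn he (xy x) \/ xy x = ainf.
Proof. by case=> [[j []]|[[]]]; [left; exists j|right]. Qed.

Lemma Et_overlap g h : g <> h -> exists c c', forall x,
  Et (xact g x) -> Et (xact h x) -> level c (ay g (xy x)) \/ level c' (ay h (xy x)).
Proof.
move=> gh; have [|c [c' H]] := @bigD_overlap _ _ _ hn he (gmul h (ginv g)).
  by move=> E; apply: gh; rewrite -(gmul1g g) -E -gmulA gmulVg gmulg1.
exists c, c' => x Eg Eh.
have hE : ay (gmul h (ginv g)) (ay g (xy x)) = ay h (xy x) by rewrite ayM ayK.
have := H (ay g (xy x)); rewrite hE; apply.
- exact: Et_level Eg.
- exact: Et_level Eh.
(* The case left out by [bigD_overlap]: over a^oo both points of E are the base point, and freeness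
   gives g = h. *)
move=> [Y1 Y2].
have kE x1 : Et x1 -> xy x1 = ainf -> xk x1 = k0.
  by move=> + E; case=> [[j []]|[[]]//]; rewrite E => /level_ainf.
have K1 := kE _ Eg Y1; have K2 := kE _ Eh Y2; apply: gh.
have : gmul h (ginv g) = gone G.
  apply: (@orbit_free _ _ _ hn he _ k0); rewrite ?ayM ?akM.
    by rewrite -{1}Y1 ayK Y2.
  by rewrite -{1}K1 akK; exact: K2.
by move=> E; rewrite -(gmul1g g) -E -gmulA gmulVg gmulg1.
Qed.

(** The odometer is ultrametric and the group acts by isometries, so these sets are balls, and two
    balls are nested or disjoint. *)
Lemma ball_noncrossing g g' m m' : exists b b' : bool, forall k,
  ~ (`[< bagree m (ak g k) k0 >] = b /\ `[< bagree m' (ak g' k) k0 >] = b').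
Proof.
wlog mm : g g' m m' / (m <= m')%N.
  move=> W; have [mm|mm] := leqP m m'; first exact: W.
  have [b [b' H]] := W g' g m' m (ltnW mm).
  by exists b', b => k [h1 h2]; apply: (H k).
have [[kk [h1 h2]]|no] := pselect (exists kk, bagree m (ak g kk) k0 /\ bagree m' (ak g' kk) k0).
  exists false, true => k [/asboolP k1 /asboolP k2]; apply: k1.
  have : bagree m' (ak g' k) (ak g' kk) by move=> i im; rewrite k2 // h2.
  move=> /(ak_agree he (ginv g')); rewrite !akK => /(bagreeW mm) /(ak_agree he g) H.
  by move=> i im; rewrite H // h1.
by exists true, true => k [/asboolP k1 /asboolP k2]; apply: no; exists k.
Qed.

(** Each pair from [r] contributes two exceptional levels, listed in [rc], which has 2 (size r)^2
    entries. At an exceptional level, membership in E is decided by a cylinder and an odometer ball,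
    and both families are non-crossing. Away from these levels at most one translate contains the
    point, and its position in [r] gives the last factor. *)
Lemma few_Et (r : seq G) (N := (2 * size r ^ 2).+1) :
  few_classes (same_Et r) (N * N * (size r).+1).
Proof.
have /choice[cf Hcf] : forall gh : G * G, exists cc : int * int, gh.1 <> gh.2 ->
    forall x, Et (xact gh.1 x) -> Et (xact gh.2 x) ->
    level cc.1 (ay gh.1 (xy x)) \/ level cc.2 (ay gh.2 (xy x)).
  move=> [g h] /=; have [->|N0] := pselect (g = h); first by exists (0%R, 0%R).
  by have [c [c' H]] := Et_overlap N0; exists (c, c').
pose rc : seq (G * int) := [seq (g, (cf (g, h)).1) | g <- r, h <- r] ++
  [seq (h, (cf (g, h)).2) | g <- r, h <- r].
have rcN : (size rc).+1 = N by rewrite size_cat !size_allpairs /N; congr _.+1; lia.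
pose P (j : G * int) x := ay (gmul (apow (- j.2)%R) j.1) (xy x) 0%N == lb.
have PE j x : P j x <-> level j.2 (ay j.1 (xy x)).
  by rewrite /P /level ayM; split=> /eqP.
(* At level c = 2^j the condition on the bits is agreement on [j] of them; [trunc_log] recovers that
   exponent from c. *)
pose Q (j : G * int) x := `[< bagree (trunc_log 2 `|j.2|%N) (ak j.1 (xk x)) k0 >].
have [j j'|c [c1 c2]] := @noncrossing_classes xpt _ P rc.
  have [b [b' nb]] := letter_noncrossing he (gmul (apow (- j.2)%R) j.1)
    (gmul (apow (- j'.2)%R) j'.1) lb lb.
  by exists b, b' => x; exact: nb.
have [j j'|d [d1 d2]] := @noncrossing_classes xpt _ Q rc.
  have [b [b' nb]] := ball_noncrossing j.1 j'.1 (trunc_log 2 `|j.2|%N) (trunc_log 2 `|j'.2|%N).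
  by exists b, b' => x; exact: nb.
pose sp x g := `[< Et (xact g x) /\ forall c, (g, c) \in rc -> ~ level c (ay g (xy x)) >].
have F1 : few_classes (fun x x' => forall j, j \in rc -> P j x = P j x') N.
  by exists c; split=> [x|x x' /c2//]; rewrite -rcN ltnS.
have F2 : few_classes (fun x x' => forall j, j \in rc -> Q j x = Q j x') N.
  by exists d; split=> [x|x x' /d2//]; rewrite -rcN ltnS.
have F3 : few_classes (fun x x' => find (sp x) r = find (sp x') r) (size r).+1.
  by exists (fun x => find (sp x) r); split=> // x; rewrite ltnS find_size.
apply: few_sub (few_and (few_and F1 F2) F3) _ => x x' [[H1 H2] H3].
suff H x1 x2 g : (forall j, j \in rc -> P j x1 = P j x2) ->
  (forall j, j \in rc -> Q j x1 = Q j x2) -> find (sp x1) r = find (sp x2) r ->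
  g \in r -> Et (xact g x1) -> Et (xact g x2).
  by move=> g gr; split; apply: H => // j jr; rewrite ?H1 ?H2.
move=> {x x' H1 H2 H3} H1 H2 H3 gr E1.
have [[c0 [rc0 lc0]]|no] := pselect (exists c, (g, c) \in rc /\ level c (ay g (xy x1))).
  have lc2 : level c0 (ay g (xy x2)).
    by apply/(PE (g, c0)); rewrite -H1 //; apply/(PE (g, c0)).
  case: E1 => [[j [/= lj bj]]|[[/= Y1 _] _]]; last first.
    by move: lc0; rewrite Y1 => /level_ainf.
  have cj : c0 = (2 ^ j)%N by exact: level_uniq lc0 lj.
  left; exists j; rewrite /= -cj; split=> //.
  have := H2 _ rc0; rewrite /Q /= cj absz_nat trunc_expnK // => q.
  by apply/asboolP; rewrite -q; apply/asboolP.
have spg : sp x1 g by apply/asboolP; split=> // c0 rc0 lc0; apply: no; exists c0.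
have hs : has (sp x1) r by apply/hasP; exists g.
pose h := nth g r (find (sp x1) r).
have sh : sp x1 h by exact: nth_find.
have hr : h \in r by rewrite mem_nth // -has_find.
have hs2 : has (sp x2) r by rewrite has_find -H3 -has_find.
have sh2 : sp x2 h by rewrite /h H3; exact: nth_find.
have [gh|gh] := pselect (g = h); first by move: sh2; rewrite -gh => /asboolP[].
move: sh => /asboolP[Eh nh].
have [l1|l2] := Hcf (g, h) gh x1 E1 Eh.
  case: no; exists (cf (g, h)).1; split=> //; rewrite mem_cat; apply/orP; left.
  by apply/allpairsP; exists (g, h).
exfalso; apply: nh l2; rewrite mem_cat; apply/orP; right.
by apply/allpairsP; exists (g, h).
Qed.

Definition same_cell (r : seq G) M x x' :=
  [/\ same_letters r x x', same_Et r x x' & bagree M (xk x) (xk x')].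

Lemma same_cellW r r' M M' x x' : {subset r <= r'} -> (M <= M')%N ->
  same_cell r' M' x x' -> same_cell r M x x'.
Proof.
move=> rr MM [h1 h2 h3]; split; [|by move=> g /rr /h2|exact: bagreeW h3].
by move=> g /rr /h1.
Qed.

Lemma same_cell_agree N : exists r M, forall x x',
  same_cell r M x x' -> agree (@xcoord _ _ e hn he) N x x'.
Proof.
elim: N => [|N [r [M IH]]]; first by exists [::], 0%N.
case E : (unpickle N : option (xidx n)) => [j|]; last first.
  exists r, M => x x' H i; rewrite ltnS leq_eqVlt => /orP[/eqP iN|]; last exact: IH.
  by move: E; rewrite -iN pickleK.
suff [r' [M' H']] : exists r M, forall x x', same_cell r M x x' ->
    xcoord (he := he) (hn := hn) j x = xcoord j x'.
  exists (r ++ r'), (maxn M M') => x x' H i; rewrite ltnS leq_eqVlt => /orP[/eqP iN|].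
    move: E; rewrite -iN pickleK => -[->]; apply: H'.
    by apply: same_cellW H => [g gr|]; rewrite ?mem_cat ?gr ?orbT ?leq_maxr.
  apply: IH; apply: same_cellW H => [g gr|]; by rewrite ?mem_cat ?gr ?leq_maxl.
case: j {E} => [[[i l]|i]|w].
- have [r' H] := prefix_translates he i.+1; exists r', 0%N => x x' [h _ _] /=.
  by rewrite (H _ _ h).
- by exists [::], i.+1 => x x' [_ _ h] /=; rewrite h.
- exists [:: weval e w], 0%N => x x' [_ h _]; apply: asbool_equiv_eq; apply: h.
  exact: mem_head.
Qed.

Lemma cover_lebesgue (m : nat) (U : 'I_m -> set Xs) : (forall i, open (U i)) ->
  \bigcup_i U i = [set: Xs] ->
  exists r M, forall x, exists i, forall x', same_cell r M x x' -> U i x'.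
Proof.
move=> oU cU; have /choice[f Hf] : forall x : Xs, exists i, U i x.
  by move=> x; have : [set: Xs] x by []; rewrite -cU => -[i _]; exists i.
have [x|N HN] := cspace_lebesgue (W := fun x => U (f x)) (@Xs_compact R _ _ _ hn he).
  exact: open_nbhs_nbhs.
have [r [M HrM]] := same_cell_agree N.
exists r, M => x; have [x1 H1] := HN x; exists (f x1) => x' /HrM; exact: H1.
Qed.

Lemma same_cell_act r M g x x' : same_cell [seq gmul h g | h <- r] M x x' ->
  same_cell r M (xact g x) (xact g x').
Proof.
move=> [h1 h2 h3]; split=> [h hr|h hr|] /=; last exact: ak_agree.
  by rewrite -!ayM; apply: h1; exact: map_f.
by rewrite -!xactM; apply: h2; exact: map_f.
Qed.

(** For q translates of a fixed finite list, first letters give a factor linear in q, translates of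
    E one of degree 5 (two non-crossing families of quadratic size and one position), and the
    odometer bits a constant: hence the exponent 6. *)
Lemma join_cover_poly (s : nat -> G) (m : nat) (U : 'I_m -> set Xs) :
  (forall i, open (U i)) -> \bigcup_i U i = [set: Xs] ->
  exists C : nat, (0 < C)%N /\ forall q,
    (covnum (@join_cover G Xs (@xact _ _ _ hn he) s m U q) <= C * q.+1 ^ 6)%N.
Proof.
move=> oU cU; have [r [M HrM]] := cover_lebesgue oU cU.
pose D := (2 * (size r).+1 * (#|{: letter n}|).+1)%N.
exists (D ^ 6 * 2 ^ M)%N; split; first by rewrite muln_gt0 !expn_gt0.
move=> q.
pose rq := [seq gmul h (s i.+1) | h <- r, i <- iota 0 q].
have srq : size rq = (size r * q)%N by rewrite size_allpairs size_iota.
have few := few_and (few_and (few_letters rq) (few_Et rq)) (few_bits M).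
apply: leq_trans (few_covnum few _) _.
  move=> x; have /choice[j Hj] : forall i : 'I_q, exists j, forall x',
      same_cell r M (xact (s i.+1) x) x' -> U j x' by move=> i; exact: HrM.
  exists j => x' [[h1 h2] h3] i; apply: Hj; apply: same_cell_act.
  apply: same_cellW (And3 h1 h2 h3) => // g /mapP[h hr ->].
  by apply/allpairsP; exists (h, i : nat); split=> //=; rewrite mem_iota add0n leq0n /= ltn_ord.
pose B := (D * q.+1)%N.
have -> : (D ^ 6 * 2 ^ M * q.+1 ^ 6 = B * (B ^ 2 * B ^ 2 * B) * 2 ^ M)%N.
  by rewrite mulnAC -expnMn -/B; congr (_ * _)%N; rewrite -expnD -expnSr -expnS.
rewrite srq.
have b1 : (size r * q * #|{: letter n}| < B)%N by rewrite /B /D; nia.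
have b2 : (size r * q < B)%N by rewrite /B /D; nia.
have b3 : (2 * (size r * q) ^ 2 < B ^ 2)%N.
  rewrite -!mulnn; have : (2 * (size r * q) <= B)%N by rewrite /B /D; nia.
  nia.
by rewrite !leq_mul.
Qed.

End Null.

Local Open Scope ring_scope.

(** * Vanishing of sequence entropy under polynomial growth *)

Lemma ln_sqrt_bound (R : realType) (x : R) : 0 < x -> ln x <= 2 * Num.sqrt x.
Proof.
move=> x0; have s0 : 0 < Num.sqrt x by rewrite sqrtr_gt0.
rewrite -{1}(sqr_sqrtr (ltW x0)) lnXn // mulr_natl lerMn2r /=.
exact/ltW/ln_sublinear.
Qed.

Lemma poly_growth_esup (R : realType) (u : nat -> nat) (C d : nat) : (0 < C)%N ->
  (forall q, (u q <= C * q.+1 ^ d)%N) ->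
  limn_esup (fun q => (ln ((u q)%:R : R) / q%:R)%:E) = 0%E.
Proof.
(* With s = sqrt (q + 1) one has ln (u q) <= ln C + 2 d s, and s <= s^2 <= 2 q bounds s ln (u q) / q
   by 2 ln C + 4 d. *)
move=> C0 Hu; pose K : R := 2 * ln C%:R + 4 * d%:R.
have C1 : 1 <= C%:R :> R by rewrite ler1n.
have lC : 0 <= ln C%:R :> R by exact: ln_ge0.
pose v q : R := K * Num.sqrt (harmonic q).
have v0 : v @ \oo --> 0.
  rewrite -[0](mulr0 K); apply: cvgMr.
  rewrite -[in X in _ --> X](@sqrtr0 R); apply: continuous_cvg.
    exact: sqrt_continuous.
  exact: cvg_harmonic.
have lu q : 0 <= ln ((u q)%:R : R).
  by case: (u q) => [|j]; [rewrite ln0|rewrite ln_ge0 // ler1n].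
have bound q : (0 < q)%N -> ln ((u q)%:R : R) / q%:R <= v q.
  move=> q0.
  have q0R : 0 < q%:R :> R by rewrite ltr0n.
  have H1 : ln ((u q)%:R : R) <= ln C%:R + d%:R * (2 * Num.sqrt q.+1%:R).
    have [->|u0] := posnP (u q).
      by rewrite ln0 // addr_ge0 // mulr_ge0 // mulr_ge0 // sqrtr_ge0.
    apply: (@le_trans _ _ (ln (C%:R * q.+1%:R ^+ d))).
      rewrite ler_ln ?posrE ?ltr0n // ?mulr_gt0 ?exprn_gt0 ?ltr0n //.
      by rewrite -natrX -natrM ler_nat.
    rewrite lnM ?posrE ?exprn_gt0 ?ltr0n // lerD2l lnXn ?ltr0n // -[X in X <= _]mulr_natl.
    by rewrite ler_wpM2l // ln_sqrt_bound.
  pose s : R := Num.sqrt q.+1%:R.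
  have s1 : 1 <= s by rewrite -(@sqrtr1 R) ler_sqrt // ler1n.
  have s2 : s * s = q.+1%:R by rewrite -expr2 sqr_sqrtr.
  have vE : v q = K / s by rewrite /v /harmonic /= sqrtrV.
  rewrite vE ler_pdivrMr // mulrAC ler_pdivlMr; last by lra.
  have q2 : s * s <= 2 * q%:R by rewrite s2 -natrM ler_nat; lia.
  apply: (@le_trans _ _ ((ln C%:R + d%:R * (2 * s)) * s)).
    by rewrite ler_wpM2r //; lra.
  have d0 : 0 <= d%:R :> R by [].
  have : ln C%:R * s <= ln C%:R * (s * s).
    by rewrite ler_wpM2l //; nra.
  have : ln C%:R * (s * s) <= ln C%:R * (2 * q%:R) by rewrite ler_wpM2l.
  have : d%:R * (s * s) <= d%:R * (2 * q%:R) by rewrite ler_wpM2l.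
  rewrite /K; nra.
have cv : (fun q => ln ((u q)%:R : R) / q%:R) @ \oo --> 0.
  apply: (squeeze_cvgr (f := fun=> 0) (h := v)) => //; last exact: cvg_cst.
  exists 1%N => // q /= q0; rewrite bound // andbT divr_ge0 //.
have cvE : (fun q => (ln ((u q)%:R : R) / q%:R)%:E) @ \oo --> 0%E.
  by apply: cvg_EFin => //; exact: nearW.
rewrite is_cvg_limn_esupE; first exact: cvg_lim cvE.
by apply/cvg_ex; exists 0%E.
Qed.

Lemma xact_null (R : realType) (G : group) (n : nat) (e : 'I_n -> G)
    (hn : (2 <= n)%N) (he : free_basis e) :
  null_action R (@xact _ _ _ hn he : G -> Xs R hn he -> Xs R hn he).
Proof.
move=> s m U oU cU; have [C [C0 HC]] := join_cover_poly s oU cU.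
exact: poly_growth_esup HC.
Qed.

(** * Integrals of bounded functions against probabilities *)

Section ProbIntegral.
Context (d : measure_display) (T : measurableType d) (R : realType).
Variable P : probability T R.

Lemma bounded_integrable (h : T -> R) (B : R) : measurable_fun setT h ->
  (forall x, `|h x| <= B) -> P.-integrable setT (EFin \o h).
Proof.
move=> mh hB; apply: measurable_bounded_integrable => //.
  by apply: (@le_lt_trans _ _ 1%E); [exact: probability_le1|exact: ltry].
exists B; split; first exact: num_real.
by move=> x Bx t _ /=; apply: le_trans (hB t) (ltW Bx).
Qed.

Lemma Rintegral_bound (h : T -> R) (A : set T) (eps D : R) :
  measurable A -> measurable_fun setT h -> 0 <= D ->
  (forall x, A x -> `|h x| <= eps) -> (forall x, `|h x| <= eps + D) ->
  `|Rintegral P setT h| <= eps + D * fine (P (~` A)).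
Proof.
move=> mA mh D0 hA hD.
have ih := bounded_integrable mh hD.
apply: le_trans (le_normr_Rintegral measurableT ih) _.
have mC : measurable (~` A) by exact: measurableC.
have i1 : P.-integrable setT (EFin \o (fun=> eps)).
  by apply: (@bounded_integrable _ `|eps|) => //; exact: measurable_cst.
have i2 : P.-integrable setT (EFin \o (fun x => \1_(~` A) x)).
  apply: (@bounded_integrable _ 1) => [|x]; first exact: measurable_indic.
  by rewrite indicE; case: (_ \in _); rewrite ?normr1 ?normr0.
have i3 : P.-integrable setT (EFin \o (fun x => D * \1_(~` A) x)).
  apply: (@bounded_integrable _ D) => [|x].
    by apply: measurable_funM; [exact: measurable_cst|exact: measurable_indic].
  by rewrite indicE; case: (_ \in _); rewrite ?mulr1 ?mulr0 ?normr0 // ger0_norm.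
have -> : eps + D * fine (P (~` A)) = Rintegral P setT (fun x => eps + D * \1_(~` A) x).
  rewrite RintegralD // RintegralZl // Rintegral_cst //.
  rewrite [X in eps * fine X](_ : _ = 1%E); last exact: probability_setT.
  rewrite /= mulr1; congr (_ + _ * _).
  by rewrite /Rintegral integral_indic // setIT.
apply: le_Rintegral => //.
- apply: (@bounded_integrable _ (eps + D)) => [|x]; last by rewrite normr_id.
  exact: measurableT_comp.
- apply: (@bounded_integrable _ (`|eps| + D)) => [|x].
    by apply: measurable_funD; [|apply: measurable_funM]; try exact: measurable_cst; exact: measurable_indic.
  apply: le_trans (ler_normD _ _) _; rewrite lerD2l.
  by rewrite indicE; case: (_ \in _); rewrite ?mulr1 ?mulr0 ?normr0 // ger0_norm.
move=> x _; rewrite indicE; have [|xA] := boolP (x \in ~` A); first by rewrite mulr1.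
rewrite mulr0 addr0; apply: hA.
by move: xA; rewrite notin_setE /= => /contrapT.
Qed.

End ProbIntegral.

Section ContinuousFunctions.
Variables (R : realType) (X : ptopologicalType).

Lemma continuous_borel (f : X -> R) : continuous f ->
  measurable_fun [set: borel X] (f : borel X -> R).
Proof.
move=> cf; apply: (measurability (@RGenOInfty.G R)); first exact: RGenOInfty.measurableE.
move=> _ [_ [x ->] <-]; rewrite setTI; apply: sub_sigma_algebra.
by move/continuousP: cf; apply; exact: interval_open.
Qed.

Lemma continuous_borel_map (Z : ptopologicalType) (f : X -> Z) : continuous f ->
  measurable_fun [set: borel X] (f : borel X -> borel Z).
Proof.
move=> cf; apply: measurability; first by rewrite /measurable /=.
move=> _ [A oA <-]; rewrite setTI; apply: sub_sigma_algebra.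
by move/continuousP: cf; apply.
Qed.

Lemma continuous_bounded (f : X -> R) : compact [set: X] -> continuous f ->
  exists2 B, 0 <= B & forall x, `|f x| <= B.
Proof.
move=> cX cf.
have /compact_bounded[M [_ HM]] : compact (f @` [set: X]).
  by apply: continuous_compact => //; exact: continuous_subspaceT.
exists (`|M| + 1); first by rewrite addr_ge0.
by move=> x; apply: (HM (`|M| + 1)) => //; have := ler_norm M; lra.
Qed.

End ContinuousFunctions.

(** * Strong proximality of the boundary *)

Section Proximal.
Variables (R : realType) (G : group) (n : nat) (e : 'I_n -> G).
Hypotheses (hn : (2 <= n)%N) (he : free_basis e).
Implicit Types (l : letter n) (y z : ray n) (g h : G).
Local Notation ay := (ay he).
Local Notation la := (la hn).
Local Notation lb := (lb hn).
Local Notation ainf := (ainf hn).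
Local Notation Ys := (Ys R hn).
Local Notation prob := (prob R Ys).

Lemma open_prefix m y : open ([set z | yagree m y z] : set Ys).
Proof.
rewrite openE => z yz; apply: filterS (@yagree_nbhs R _ hn m z) => u zu i im.
by rewrite yz // zu.
Qed.

Lemma open_head g l : open ([set y | ay g y 0%N = l] : set Ys).
Proof.
rewrite openE => y yl; have [M HM] := ay_modulus he g 1.
by apply: filterS (@yagree_nbhs R _ hn M y) => z /HM /(_ 0%N isT) /= <-.
Qed.

Lemma rword_nseq l m : rword (nseq m l).
Proof. by elim: m => [|[|m] IH] //=; rewrite const_rayP. Qed.

Lemma last_nseq l l' m : (0 < m)%N -> last l' (nseq m l) = l.
Proof. by elim: m l' => // -[|m] IH l' _ //=; rewrite -[RHS](IH l). Qed.

Lemma ay_nseq l m y : y 0%N != linv l ->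
  forall i, (i < m)%N -> ay (weval e (nseq m l)) y i = l.
Proof.
move=> hy i im; have m0 : (0 < m)%N by lia.
by rewrite ay_rword ?rword_nseq ?last_nseq // size_nseq im nth_nseq im.
Qed.

(** The cylinder of b^j a^-1, written as the preimage of the cylinder of a^-1 under b^-j. These
    cylinders are disjoint, so any probability gives small mass to one of them. *)
Definition bcell j : set Ys := [set y | ay (weval e (nseq j (linv lb))) y 0%N = linv la].

Lemma bcell_trivI : trivIset setT bcell.
Proof.
suff H i j : (i < j)%N -> bcell i `&` bcell j = set0.
  apply/trivIsetP => i j _ _ ij; have [/H//|ji|E] := ltngtP i j.
    by rewrite setIC; exact: H.
  by rewrite E eqxx in ij.
move=> ij; apply/seteqP; split=> // y [/= h1]; rewrite /bcell /=.
rewrite -(subnK (ltnW ij)) nseqD weval_cat ayM.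
by rewrite ay_nseq ?h1 ?subn_gt0 // => -[].
Qed.

Lemma small_bcell (mu : prob) N : exists j, (mu (bcell j) <= N.+1%:R^-1%:E)%E.
Proof.
apply: contrapT => H.
have mb j : measurable (bcell j : set (borel Ys)).
  by apply: sub_sigma_algebra; exact: open_head.
have big j : (N.+1%:R^-1%:E <= mu (bcell j))%E.
  by rewrite leNgt; apply/negP => h; apply: H; exists j; exact: ltW.
have : (mu (\big[setU/set0]_(j < N.+2) bcell j) <= 1)%E.
  by apply: probability_le1; apply: bigsetU_measurable.
rewrite measure_semi_additive_ord_I //; last 2 first.
- exact: sub_trivIset bcell_trivI.
- exact: bigsetU_measurable.
apply/negP; rewrite -ltNge.
apply: (@lt_le_trans _ _ (\sum_(j < N.+2) N.+1%:R^-1%:E)%E);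
  last by apply: lee_sum => j _; exact: big.
rewrite sumEFin sumr_const card_ord lte_fin -[X in _ < X]mulr_natl ltr_pdivlMr //.
by rewrite mul1r ltr_nat.
Qed.

(** A closed invariant set contains the point mass at a^oo: otherwise a basic neighbourhood of that
    mass misses the set, yet some translate of [mu] enters it. *)
Lemma ay_strongly_proximal : strongly_proximal R (ay : G -> Ys -> Ys).
Proof.
move=> C cC [mu Cmu] iC.
pose dl : prob := (dirac (ainf : borel Ys) : probability (borel Ys) R).
exists dl, ainf; split; last by [].
apply: contrapT => /cC[k [f [eps [eps0 [cf H]]]]].
have /choice[b Hb] : forall i, exists B, 0 <= B /\ forall y, `|f i y| <= B.
  by move=> i; have [B B0 HB] := continuous_bounded (@Ys_compact R _ hn) (cf i); exists B.
have /choice[m Hm] : forall i, exists m, forall z, yagree m ainf z -> `|f i z - f i ainf| < eps / 2.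
  move=> i; have /cvgrPdist_lt/(_ (eps / 2))[] := cf i ainf; first by rewrite divr_gt0.
  move=> N HN; have [M HM] := yagree_agree n N; exists M => z /HM /HN /=.
  by rewrite distrC.
pose B := \sum_(i < k) b i.
have bB i : b i <= B.
  by rewrite /B (bigD1 i) //= lerDl sumr_ge0 // => j _; exact: (Hb j).1.
have B0 : 0 <= B by rewrite sumr_ge0 // => j _; exact: (Hb j).1.
pose M := \max_(i < k) m i.
(* Test functions vary by at most 2 B, so a mass of at most 1/(N + 1) away from a^oo costs less than
   eps / 2. *)
pose N := Num.truncn (4 * B / eps).
have HN : 2 * B * N.+1%:R^-1 < eps / 2.
  have := truncnS_gt (4 * B / eps); rewrite -/N => h.
  rewrite ltr_pdivrMr //; move: h; rewrite ltr_pdivrMr //; lra.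
(* A power of b^-1 makes the mass of the cylinder of a^-1 small; then a^M moves
   everything outside that cylinder into the prefix a^M. *)
have [j Hj] := small_bcell mu N.
have [nu1 Cnu1 push1] := iC (weval e (nseq j (linv lb))) _ Cmu.
have [nu2 Cnu2 push2] := iC (weval e (nseq M la)) _ Cnu1.
apply: (H nu2 Cnu2) => i.
pose A : set (borel Ys) := [set z | yagree M ainf z].
have mA : measurable A by apply: sub_sigma_algebra; exact: open_prefix.
have nuA : (nu2 (~` A) <= N.+1%:R^-1%:E)%E.
  rewrite push2; last exact: measurableC.
  have m1 : measurable ([set y | ay (gone G) y 0%N = linv la] : set (borel Ys)).
    by apply: sub_sigma_algebra; exact: open_head.
  apply: (@le_trans _ _ (nu1 [set y | ay (gone G) y 0%N = linv la])).
    apply: le_measure; rewrite ?inE //.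
      have := continuous_borel_map (@ay_continuous R _ _ _ hn he (weval e (nseq M la))).
      by move=> /(_ measurableT _ (measurableC mA)); rewrite setTI.
    move=> y /= nA; rewrite ay1; apply: contrapT => /eqP y0; apply: nA => q qM.
    by rewrite ay_nseq.
  rewrite push1 //; apply: le_trans Hj; apply: le_measure; rewrite ?inE //.
  - have := continuous_borel_map (@ay_continuous R _ _ _ hn he (weval e (nseq j (linv lb)))).
    by move=> /(_ measurableT _ m1); rewrite setTI.
  - by apply: sub_sigma_algebra; exact: open_head.
  - by move=> y /=; rewrite ay1.
have mf := continuous_borel (cf i).
have mintd : mint dl (f i) = f i ainf.
  rewrite /mint /Rintegral integral_dirac //; last exact/measurable_EFinP.
  by rewrite diracT mul1e.
rewrite mintd.
have i1 : nu2.-integrable [set: borel Ys] (EFin \o (f i : borel Ys -> R)).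
  by apply: (@bounded_integrable _ _ _ _ _ (b i)) => //; exact: (Hb i).2.
have i2 : nu2.-integrable [set: borel Ys] (EFin \o (fun=> f i ainf)).
  by apply: (@bounded_integrable _ _ _ _ _ `|f i ainf|) => //; exact: measurable_cst.
have -> : mint nu2 (f i) - f i ainf = Rintegral nu2 setT (fun y => f i y - f i ainf).
  rewrite RintegralB // Rintegral_cst //.
  by rewrite [X in _ * fine X](_ : _ = 1%E) ?mulr1 //; exact: probability_setT.
apply: (@le_lt_trans _ _ (eps / 2 + 2 * B * fine (nu2 (~` A)))).
  apply: Rintegral_bound => //.
  - by apply: measurable_funB => //; exact: measurable_cst.
  - by rewrite mulr_ge0.
  - move=> y Ay; apply/ltW/Hm; apply: yagreeW Ay; exact: leq_bigmax.
  - move=> y; apply: le_trans (ler_normB _ _) _.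
    have := (Hb i).2 y; have := (Hb i).2 ainf; have := bB i; lra.
have : fine (nu2 (~` A)) <= N.+1%:R^-1.
  rewrite -lee_fin fineK //; apply: fin_num_measure; exact: measurableC.
move=> h; apply: (@le_lt_trans _ _ (eps / 2 + 2 * B * N.+1%:R^-1)); last by rewrite [ltRHS]splitr ltrD2l.
by rewrite lerD2l ler_wpM2l // mulr_ge0.
Qed.

End Proximal.

Section PushProb.
Context (d d' : measure_display) (T : measurableType d) (T' : measurableType d').
Context (R : realType) (P : probability T R) (f : T -> T').
Hypothesis mf : measurable_fun setT f.

Let fm : {mfun T >-> T'} := HB.pack_for {mfun T >-> T'} f (isMeasurableFun.Build _ _ _ _ f mf).

Definition push_prob : probability T' R := distribution P fm.

Lemma push_probE A : push_prob A = P (f @^-1` A).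
Proof. by []. Qed.

Lemma Rintegral_push (h : T' -> R) (B : R) : measurable_fun setT h ->
  (forall x, `|h x| <= B) ->
  Rintegral push_prob setT h = Rintegral P setT (h \o f).
Proof.
move=> mh hB; rewrite /Rintegral; congr fine.
have := @integral_pushforward _ _ T T' R f mf P setT (EFin \o h).
rewrite preimage_setT; apply => //.
- exact/measurable_EFinP.
- have mhf : measurable_fun setT (h \o f) by exact: measurableT_comp mf.
  by apply: (@bounded_integrable _ _ _ P (h \o f) B) => // x; exact: hB.
Qed.

End PushProb.

(** * Binary digits of a uniform point of the unit interval *)

Section Digits.
Variable R : realType.

Definition doubling (t : R) : R := 2 * t - ((2^-1 <= t)%R : bool)%:R.

Definition digit (t : R) (i : nat) : bool := 2^-1 <= iter i doubling t.

Lemma measurable_doubling : measurable_fun setT doubling.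
Proof.
apply: measurable_funB; first by apply: measurable_funM; [exact: measurable_cst|exact: measurable_id].
rewrite (_ : (fun _ => _) = \1_(`[2^-1, +oo[%classic)); first exact: measurable_indic.
by apply/funext => t; rewrite indicE mem_setE in_itv /= andbT.
Qed.

Lemma measurable_digit i : measurable [set t | digit t i].
Proof.
have mi : measurable_fun setT (iter i doubling).
  elim: i => [|i IH]; first exact: measurable_id.
  rewrite (_ : iter i.+1 doubling = doubling \o iter i doubling) //.
  exact: measurableT_comp measurable_doubling IH.
have := mi measurableT _ (measurable_itv `[2^-1, +oo[%R); rewrite setTI.
by rewrite (_ : _ @^-1` _ = [set t | digit t i]) //; apply/seteqP; split=> t;
  rewrite /digit /= in_itv /= andbT.
Qed.

Lemma digit_cylinder (c : seq bool) : exists2 u : R, 0 <= u & 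
  [set t | 0 <= t < 1 /\ forall i, (i < size c)%N -> digit t i = nth false c i] =
  `[u, u + 2^-1 ^+ size c[%classic /\ u + 2^-1 ^+ size c <= 1.
Proof.
elim: c => [|b c [u u0 [E u1]]] /=.
  exists 0 => //; rewrite expr0 add0r; split=> //; apply/seteqP; split=> t /=; rewrite in_itv /=.
    by case.
  by move=> ->.
have v0 : 0 < 2^-1 ^+ size c :> R by rewrite exprn_gt0.
(* Prepending the digit [b] pulls the interval back along the inverse branch t -> (b + t) / 2 of
   doubling modulo one. *)
exists ((b%:R + u) / 2); first by case: b => /=; lra.
rewrite exprS; set v := 2^-1 ^+ size c in E u1 v0 *.
split; last by case: b => /=; lra.
have H t : (0 <= t < 1 /\ forall i, (i < size c)%N -> digit t i = nth false c i) <-> u <= t < u + v.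
  by have := congr1 (fun A => A t) E; rewrite /= in_itv /= => ->.
have st t : (forall i, (i < (size c).+1)%N -> digit t i = nth false (b :: c) i) <->
    (2^-1 <= t) = b /\ forall i, (i < size c)%N -> digit (doubling t) i = nth false c i.
  have dS i : digit t i.+1 = digit (doubling t) i by rewrite /digit iterSr.
  split=> [h|[h1 h2] [|i] ic //].
    by split=> [|i ic]; [exact: (h 0%N isT)|rewrite -dS (h i.+1)].
  by rewrite dS h2.
apply/seteqP; split=> t /=; rewrite in_itv /=.
  move=> [t01 /st[tb hd]].
  have : u <= doubling t < u + v.
    by apply/H; split=> //; rewrite /doubling tb; case: b tb {st} => /= tb; move: t01; lra.
  by rewrite /doubling tb; case: b tb {st} => /= tb; lra.
move=> tI.
have tb : (2^-1 <= t) = b.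
  by case: b {st} tI => tI; [apply/idP|apply/negbTE; rewrite -ltNge]; move: tI => /=; lra.
have /H[] : u <= doubling t < u + v.
  by rewrite /doubling tb; case: b tb tI {st} => /= tb; lra.
move=> d01 hd; split; last exact/st.
by case: b tb tI {st} => /= tb; lra.
Qed.

Let I01 : set R := `[0, 1[%classic.
Let mI01 : measurable I01. Proof. exact: measurable_itv. Qed.

Definition unif01 := mrestr (@lebesgue_measure R) mI01.
HB.instance Definition _ := Measure.on unif01.

Lemma unif01T : unif01 setT = 1%E.
Proof. by rewrite /unif01 /mrestr setTI lebesgue_measure_itv /= lte_fin ltr01 oppr0 adde0. Qed.

HB.instance Definition _ := Measure_isProbability.Build _ _ _ unif01 unif01T.

Lemma unif01_cylinder (c : seq bool) :
  unif01 [set t | forall i, (i < size c)%N -> digit t i = nth false c i] =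
  (2^-1 ^+ size c)%:E.
Proof.
have [u u0 [E u1]] := digit_cylinder c.
rewrite /unif01 /mrestr (_ : _ `&` _ = `[u, u + 2^-1 ^+ size c[%classic).
  rewrite lebesgue_measure_itv /= lte_fin ltrDl exprn_gt0 //.
  by rewrite -EFinD addrAC subrr add0r.
rewrite -E; apply/seteqP; split=> t; rewrite /I01 /= in_itv /=; first by case.
by case.
Qed.

End Digits.

(** * Haar measure on the odometer *)

Section Haar.
Variable R : realType.
Local Notation Ks := (Ks R).
Implicit Types (k c : nat -> bool) (mu : prob R Ks).

Definition bcyl m c : set (borel Ks) := [set k | bagree m k c].

Lemma bcyl_measurable m c : measurable (bcyl m c).
Proof.
apply: sub_sigma_algebra; apply/cspace_openP => k kc; exists m => k' H i im.
by rewrite -kc //; apply/esym/(H i).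
Qed.

Definition bflip m c : nat -> bool := fun i => if i == m then ~~ c i else c i.

Lemma bcylS m c : bcyl m c = bcyl m.+1 c `|` bcyl m.+1 (bflip m c).
Proof.
apply/seteqP; split=> k /=.
  move=> H; have [E|N] := eqVneq (k m) (c m); [left|right] => i.
    by rewrite ltnS leq_eqVlt => /orP[/eqP->|/H].
  rewrite ltnS leq_eqVlt /bflip => /orP[/eqP->|im].
    by rewrite eqxx; move: N; case: (k m); case: (c m).
  by rewrite (ltn_eqF im) H.
by case=> H i im; rewrite H ?leqW // /bflip (ltn_eqF im).
Qed.

Lemma bcylS_disj m c : bcyl m.+1 c `&` bcyl m.+1 (bflip m c) = set0.
Proof.
apply/seteqP; split=> // k [/(_ m (ltnSn m)) H1 /(_ m (ltnSn m))].
by rewrite H1 /bflip eqxx; case: (c m).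
Qed.

Lemma bcyl0 c : bcyl 0 c = setT.
Proof. by apply/seteqP; split. Qed.

Lemma prob_eq_bcyl mu1 mu2 : (forall m c, mu1 (bcyl m c) = mu2 (bcyl m c)) ->
  forall A : set (borel Ks), measurable A -> mu1 A = mu2 A.
Proof.
move=> H; apply: prob_eq_cyl => l.
pose A : set (borel Ks) := cyl kcoord l.
have mA : measurable A by exact: cyl_measurable.
have [m Hm] : exists m, forall k k', bagree m k k' -> A k <-> A k'.
  rewrite /A; elim: l {A mA} => [|[i b] l [m Hm]]; first by exists 0%N.
  exists (maxn m i.+1) => k k' kk.
  have h1 := Hm k k' (bagreeW (leq_maxl _ _) kk).
  have h2 : kcoord i k = kcoord i k' by apply: kk; rewrite leq_max ltnSn orbT.
  rewrite /cyl /= h2; split=> /andP[-> h] /=; exact/h1.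
(* Downward induction on the depth: at depth [m] each ball lies in [A] or misses it, and a shallower
   ball is the disjoint union of two balls one level deeper. *)
suff HA j c : (j <= m)%N -> mu1 (A `&` bcyl j c) = mu2 (A `&` bcyl j c).
  by have := HA 0%N (fun=> false) isT; rewrite bcyl0 setIT.
move=> jm; rewrite -(subKn jm); elim: (m - j)%N (leq_subr j m) c => [|i IH] im c.
  rewrite subn0; have [Ac|nAc] := pselect (A c).
    rewrite (_ : A `&` bcyl m c = bcyl m c) //; apply/setIidPr => k /Hm h; exact/h.
  rewrite (_ : A `&` bcyl m c = set0) ?measure0 //; apply/seteqP; split=> // k [Ak /Hm h].
  by apply: nAc; apply/h.
have E : (m - i = (m - i.+1).+1)%N by lia.
have mb c' : measurable (A `&` bcyl (m - i.+1).+1 c').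
  by apply: measurableI => //; exact: bcyl_measurable.
rewrite bcylS setIUr.
have dj : (A `&` bcyl (m - i.+1).+1 c) `&` (A `&` bcyl (m - i.+1).+1 (bflip (m - i.+1)%N c)) = set0.
  by rewrite setIACA bcylS_disj setI0.
have a1 := measureU mu1 (mb c) (mb _) dj; have a2 := measureU mu2 (mb c) (mb _) dj.
apply: (etrans a1); apply/esym; apply: (etrans a2); apply/esym.
by congr (_ + _)%E; rewrite -E; apply: IH; lia.
Qed.

Lemma measurable_digits : measurable_fun setT (@digit R : R -> borel Ks).
Proof. by apply: cspace_measurable_fun => i; exact: measurable_digit. Qed.

Definition haar : prob R Ks := push_prob (@unif01 R) measurable_digits.

Lemma haar_bcyl m c : haar (bcyl m c) = (2^-1 ^+ m)%:E.
Proof.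
rewrite /haar push_probE -(size_mkseq c m) -(unif01_cylinder R (mkseq c m)); congr (unif01 _).
apply/seteqP; split=> t /= H i; rewrite size_mkseq => im.
  by rewrite nth_mkseq //; apply: H; rewrite size_mkseq.
by have := H i; rewrite size_mkseq nth_mkseq //; apply.
Qed.

(** Adding one permutes the balls of depth m transitively, so an invariant probability gives them
    equal mass; halving at each depth makes it 2^-m. *)
Lemma haar_unique mu :
  (forall A : set (borel Ks), measurable A -> mu (add1 @^-1` A) = mu A) ->
  forall A : set (borel Ks), measurable A -> mu A = haar A.
Proof.
move=> inv; apply: prob_eq_bcyl => m c; rewrite haar_bcyl.
have step m' c' : mu (bcyl m' (add1 c')) = mu (bcyl m' c').
  rewrite -[LHS]inv; last exact: bcyl_measurable.
  congr (mu _); apply/seteqP; split=> k /= H.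
    by have := sub1_agree H; rewrite !add1K.
  exact: add1_agree.
have iterc j m' c' : mu (bcyl m' (iter j add1 c')) = mu (bcyl m' c').
  by elim: j => //= j IH; rewrite step.
have cst m' c1 c2 : mu (bcyl m' c1) = mu (bcyl m' c2).
  have [j [_ Hj]] := odometer_transitive c1 c2 m'.
  rewrite -(iterc j m' c1); congr (mu _); apply/seteqP; split=> k /= H i im.
    by rewrite H // Hj.
  by rewrite H // Hj.
elim: m c => [|m IH] c; first by rewrite bcyl0 expr0; exact: probability_setT.
have := IH c; rewrite bcylS.
have a1 : mu (bcyl m.+1 c `|` bcyl m.+1 (bflip m c)) =
    (mu (bcyl m.+1 c) + mu (bcyl m.+1 (bflip m c)))%E.
  by apply: measureU; [exact: bcyl_measurable|exact: bcyl_measurable|exact: bcylS_disj].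
rewrite a1 (cst m.+1 (bflip m c) c) exprS.
have fn : mu (bcyl m.+1 c) \is a fin_num by apply: fin_num_measure; exact: bcyl_measurable.
rewrite -(fineK fn) -EFinD => -[] H; congr EFin; lra.
Qed.

End Haar.

(** * The relatively invariant measure *)

Section RIM.
Variables (R : realType) (G : group) (n : nat) (e : 'I_n -> G).
Hypotheses (hn : (2 <= n)%N) (he : free_basis e).
Implicit Types (l : letter n) (y z : ray n) (g h : G) (k : nat -> bool).
Local Notation ay := (ay he).
Local Notation ak := (ak he).
Local Notation lb := (lb hn).
Local Notation ainf := (ainf hn).
Local Notation binf := (binf hn).
Local Notation level := (level hn he).
Local Notation xpt := (xpt hn he).
Local Notation xplus := (xplus hn he).
Local Notation xact := (@xact _ _ _ hn he).
Local Notation Xs := (Xs R hn he).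
Local Notation Ys := (Ys R hn).
Local Notation Ks := (Ks R).
Local Notation haar := (haar R).

Lemma measurable_ak g : measurable_fun setT (ak g : borel Ks -> borel Ks).
Proof. exact: continuous_borel_map (@ak_continuous R _ _ _ he g). Qed.

Lemma measurable_xact g : measurable_fun setT (xact g : borel Xs -> borel Xs).
Proof. exact: continuous_borel_map (@xact_continuous R _ _ _ hn he g). Qed.

Lemma measurable_xk : measurable_fun setT (@xk _ _ _ hn he : borel Xs -> borel Ks).
Proof. exact: continuous_borel_map (@xk_continuous R _ _ _ hn he). Qed.

Lemma measurable_xplus y : measurable_fun setT (xplus y : borel Ks -> borel Xs).
Proof. exact: continuous_borel_map (@xplus_continuous R _ _ _ hn he y). Qed.

Lemma preimage_measurable d d' (T : measurableType d) (T' : measurableType d')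
  (f : T -> T') A : measurable_fun setT f -> measurable A -> measurable (f @^-1` A).
Proof. by move=> mf mA; rewrite -[_ @^-1` _]setTI; exact: mf. Qed.

Lemma haar_invariant g (A : set (borel Ks)) : measurable A ->
  haar (ak g @^-1` A) = haar A.
Proof.
move=> mA; rewrite -(push_probE haar (measurable_ak g)).
apply: (@prob_eq_bcyl R) mA => m c; rewrite push_probE haar_bcyl.
rewrite (_ : _ @^-1` _ = @bcyl R m (ak (ginv g) c)) ?haar_bcyl //.
apply/seteqP; split=> k /= H.
  by have := ak_agree he (ginv g) H; rewrite akK.
by have := ak_agree he g H; rewrite akVK.
Qed.

Definition rim y : prob R Xs := push_prob haar (measurable_xplus y).

Lemma rimE y A : rim y A = haar (xplus y @^-1` A).
Proof. by rewrite /rim push_probE. Qed.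

Lemma rim_push g y : is_push (xact : G -> Xs -> Xs) g (rim y) (rim (ay g y)).
Proof.
move=> A mA; rewrite !rimE -(haar_invariant g); last exact: preimage_measurable (measurable_xplus _) mA.
congr (haar _); apply/seteqP; split=> k /=; by rewrite xact_plus.
Qed.

Lemma rim_support y : msupport (rim y) `<=` @xy _ _ _ hn he @^-1` [set y].
Proof.
move=> x sx /=; apply: contrapT => N.
have [i Ni] := ray_neqP N.
have := sx _ (@coord_open R _ _ (@xcoord _ _ e hn he) (xbase hn he) (inl (inl (i, xy x i))) true) (eqxx _).
rewrite rimE (_ : _ @^-1` _ = set0) ?measure0 ?ltxx //.
by apply/seteqP; split=> // k /= /eqP E; apply: Ni.
Qed.

(* If [ay g y = ainf], the levels of the nearby [ay g z] are large, so [Et]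
   would force more than [m] zero bits. *)
Lemma Et_uniform g m (y : Ys) : \forall z \near y, forall k, ~ bagree m (ak g k) k0 ->
  Et (xact g (xplus y k)) <-> Et (xact g (xplus z k)).
Proof.
have nbh M : \forall z \near y, yagree M (ay g y) (ay g z).
  have [M' HM'] := ay_modulus he g M.
  by apply: filterS (@yagree_nbhs R _ hn M' y) => z /HM'.
have EtE z k : Et (xact g (xplus z k)) <->
    exists j : nat, level (2 ^ j)%N (ay g z) /\ bagree j (ak g k) k0.
  by split=> [[//|[_ //]]|]; left.
have [E|N] := pselect (ay g y = ainf).
  apply: filterS (nbh (2 ^ m).+1) => z yz k nk; rewrite !EtE; split=> -[j [lj bj]].
    by move: lj; rewrite E => /level_ainf.
  exfalso; apply: nk; apply: bagreeW bj; rewrite leqNgt; apply/negP => jm.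
  have [_] := (level_nat hn he (2 ^ j) (ay g z)).1 lj.
  rewrite -yz ?E //; apply: leq_trans (_ : 2 ^ m < _)%N => //.
  by rewrite ltnS leq_exp2l // ltnW.
have [c [c1 c2]] := ray_first N.
apply: filterS (nbh c.+1) => z yz k _; rewrite !EtE.
have c1' i : (i < c)%N -> ay g z i = la hn by move=> ic; rewrite -yz ?c1 //; exact: ltnW.
have c2' : ay g z c <> la hn by rewrite -yz.
have Ec : ay g z c = ay g y c by rewrite -yz.
by split=> -[j [/level_first lj bj]]; exists j; split=> //; apply/level_first;
  [exact: c1'|exact: c2'|rewrite Ec; exact: lj|exact: c1|exact: c2|rewrite -Ec; exact: lj].
Qed.

(** Union bound over the exceptional bits of [Et_uniform]: each element of [r] contributes a set of
    mass 2^-m. *)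
Lemma haar_bad_small (r : seq G) m :
  (haar [set k | exists2 g, g \in r & bagree m (ak g k) k0] <= ((size r)%:R * 2^-1 ^+ m)%:E)%E /\
  measurable ([set k | exists2 g, g \in r & bagree m (ak g k) k0] : set (borel Ks)).
Proof.
elim: r => [|g r [IH mr]].
  rewrite (_ : [set _ | _] = set0) ?measure0 ?mul0r //.
  by apply/seteqP; split=> // k [].
have mg : measurable (ak g @^-1` @bcyl R m k0 : set (borel Ks)).
  by apply: preimage_measurable (measurable_ak g) _; exact: bcyl_measurable.
rewrite (_ : [set _ | _] = (ak g @^-1` @bcyl R m k0) `|`
    [set k | exists2 g, g \in r & bagree m (ak g k) k0]); last first.
  apply/seteqP; split=> k /=.
    by case=> h; rewrite inE => /orP[/eqP->|hr]; [left|right; exists h].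
  by case=> [H|[h hr H]]; [exists g; rewrite ?mem_head|exists h; rewrite ?inE ?hr ?orbT].
split; last exact: measurableU.
apply: (le_trans (measureU2 _ mg mr)).
rewrite [X in (X + _)%E](_ : _ = (2^-1 ^+ m)%:E); last first.
  by rewrite -(@haar_bcyl R m k0); exact: haar_invariant (bcyl_measurable _ _).
by rewrite /= -[(size r).+1%:R]nat1r mulrDl mul1r EFinD leeD2l.
Qed.

Lemma half_pow_small (K eps : R) : 0 < eps -> exists m, K * 2^-1 ^+ m < eps.
Proof.
move=> e0; pose m := Num.truncn (`|K| / eps); exists m.
apply: (@le_lt_trans _ _ (`|K| / m.+1%:R)).
  apply: (@le_trans _ _ (`|K| * 2^-1 ^+ m)).
    by rewrite ler_wpM2r ?exprn_ge0 // ler_norm.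
  rewrite ler_wpM2l // exprVn lef_pV2 ?posrE ?exprn_gt0 ?ltr0n //.
  by rewrite -natrX ler_nat; apply: ltn_expl.
by rewrite ltr_pdivrMr // mulrC -ltr_pdivrMr //; exact: truncnS_gt.
Qed.

Lemma rim_mint y (f : Xs -> R) : continuous f ->
  mint (rim y) f = Rintegral haar [set: borel Ks] (fun k => f (xplus y k)).
Proof.
move=> cf; have [B B0 HB] := continuous_bounded (@Xs_compact R _ _ _ hn he) cf.
exact: (Rintegral_push haar (measurable_xplus y) (continuous_borel cf) HB).
Qed.

(** Fibers are compared at equal [k]. Outside a set of [k] of small Haar measure, the points over
    [y] and over a nearby [z] lie in the same cell for finitely many translates, so [f] differs
    little; elsewhere it differs by at most 2 B. *)
Lemma rim_continuous (f : Xs -> R) : continuous f ->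
  continuous (fun y : Ys => mint (rim y) f).
Proof.
move=> cf y; apply/(@cvgrPdist_lt _ _ _ _ (nbhs_filter (y : Ys))) => eps eps0.
have [B B0 HB] := continuous_bounded (@Xs_compact R _ _ _ hn he) cf.
have e40 : 0 < eps / 4 by rewrite divr_gt0.
have [x|N HN] := cspace_lebesgue (W := fun (x z : Xs) => `|f x - f z| < eps / 4)
    (@Xs_compact R _ _ _ hn he).
  by have /cvgrPdist_lt/(_ _ e40) := cf x.
have [r [M HrM]] := same_cell_agree hn he N.
have [m Hm] := @half_pow_small (2 * B * (size r)%:R) (eps / 4) e40.
have nearr (Q : G -> Ys -> Prop) : (forall g, \forall z \near y, Q g z) ->
    \forall z \near y, forall g, g \in r -> Q g z.
  move=> HQ; elim: (r) => [|g s IH]; first exact: filterS filterT.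
  apply: filterS (filterI (HQ g) IH) => z [h1 h2] h.
  by rewrite inE => /orP[/eqP->|/h2].
have N1 := nearr _ (fun g => Et_uniform g m y).
have N2 : \forall z \near y, forall g, g \in r -> ay g y 0%N = ay g z 0%N.
  apply: nearr => g; have [M' HM'] := ay_modulus he g 1.
  by apply: filterS (@yagree_nbhs R _ hn M' y) => z /HM' /(_ 0%N isT).
apply: filterS (filterI N1 N2) => z [H1 H2].
rewrite !rim_mint //.
pose bad : set (borel Ks) := [set k | exists2 g, g \in r & bagree m (ak g k) k0].
have [badl mbad] := haar_bad_small r m; rewrite -/bad in badl mbad.
have mfx u : measurable_fun setT ((fun k => f (xplus u k)) : borel Ks -> R).
  exact: (measurableT_comp (continuous_borel cf) (measurable_xplus u)).
have ifx u : haar.-integrable setT (EFin \o ((fun k => f (xplus u k)) : borel Ks -> R)).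
  by apply: (@bounded_integrable _ _ _ _ _ B) => // k; exact: HB.
rewrite -RintegralB //.
apply: (@le_lt_trans _ _ (eps / 2 + 2 * B * fine (haar (~` ~` bad)))).
  apply: Rintegral_bound.
  - exact: measurableC.
  - exact: measurable_funB.
  - by rewrite mulr_ge0.
  - move=> k nb /=.
    have ag : agree (@xcoord _ _ e hn he) N (xplus y k) (xplus z k).
      apply: HrM; split=> //.
      by move=> g gr; apply: H1 => // bg; apply: nb; exists g.
    have [x1 Hx1] := HN (xplus y k).
    have h1 := Hx1 (xplus y k) (fun _ _ => erefl); have h2 := Hx1 _ ag.
    have := ler_distD (f x1) (f (xplus y k)) (f (xplus z k)).
    rewrite (distrC (f (xplus y k)) (f x1)) => h3; lra.
  - move=> k /=; apply: le_trans (ler_normB _ _) _.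
    have := HB (xplus y k); have := HB (xplus z k); lra.
rewrite setCK.
have fb : fine (haar bad) <= (size r)%:R * 2^-1 ^+ m.
  by rewrite -lee_fin fineK //; apply: fin_num_measure.
apply: (@le_lt_trans _ _ (eps / 2 + 2 * B * ((size r)%:R * 2^-1 ^+ m))).
  by rewrite lerD2l ler_wpM2l // mulr_ge0.
by rewrite mulrA; lra.
Qed.

Lemma rim_is_RIM : is_RIM (xact : G -> Xs -> Xs) (ay : G -> Ys -> Ys)
  (@xy _ _ _ hn he : Xs -> Ys) rim.
Proof. by split; [exact: rim_continuous|exact: rim_push|exact: rim_support]. Qed.

End RIM.

(** * Uniqueness of the relatively invariant measure *)

Section UniqueRIM.
Variables (R : realType) (G : group) (n : nat) (e : 'I_n -> G).
Hypotheses (hn : (2 <= n)%N) (he : free_basis e).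
Local Notation ay := (ay he).
Local Notation ak := (ak he).
Local Notation lb := (lb hn).
Local Notation ainf := (ainf hn).
Local Notation binf := (binf hn).
Local Notation xpt := (xpt hn he).
Local Notation xplus := (xplus hn he).
Local Notation xact := (@xact _ _ _ hn he).
Local Notation xy := (@xy _ _ _ hn he).
Local Notation xk := (@xk _ _ _ hn he).
Local Notation Xs := (Xs R hn he).
Local Notation Ys := (Ys R hn).
Local Notation Ks := (Ks R).
Local Notation haar := (haar R).
Local Notation rim := (rim R hn he).

Lemma binf_fiber (x : xpt) : xy x = binf -> x = xplus binf (xk x).
Proof.
move=> E; apply: xpt_eq => //=; apply/negbTE/negP => /xP[g []].
by rewrite E => /binf_not_orbit.
Qed.

Lemma fiberC_open y : open (~` [set x : Xs | xy x = y]).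
Proof.
apply/cspace_openP => x /= N.
have [i Ni] := ray_neqP N.
have [M HM] := (cspace_nbhsP _ _).1 (@xy_near R _ _ _ hn he i.+1 x).
by exists M => z /HM H E; apply: Ni; rewrite (H i) // E.
Qed.

Section Unique.
Variable rho : Ys -> prob R Xs.
Hypothesis rhoP : is_RIM (xact : G -> Xs -> Xs) (ay : G -> Ys -> Ys) (xy : Xs -> Ys) rho.

Lemma rim_off_fiber y : rho y (~` [set x | xy x = y]) = 0%E.
Proof.
have [_ _ supp] := rhoP.
apply: prob_null_cover; first by apply: open_measurable_cspace; exact: fiberC_open.
move=> x Nx; apply: contrapT => H; apply: Nx; apply: (supp y x) => U oU Ux.
rewrite lt_neqAle measure_ge0 andbT; apply/negP => /eqP E.
by apply: H; exists U; split.
Qed.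

(* The fiber over [binf] is not blown up and [gen e lb] acts on it as the
   odometer, whose only invariant probability is [haar]. *)
Lemma rim_at_binf (A : set (borel Xs)) : measurable A -> rho binf A = rim binf A.
Proof.
move=> mA; have [_ push _] := rhoP.
pose kap : prob R Ks := push_prob (rho binf) (@measurable_xk R _ _ _ hn he).
have kapE S : kap S = rho binf (xk @^-1` S) by rewrite /kap push_probE.
have kaph : forall S : set (borel Ks), measurable S -> kap S = haar S.
  apply: haar_unique => S mS; rewrite !kapE.
  have mS' : measurable (xk @^-1` S : set (borel Xs)).
    exact: preimage_measurable (@measurable_xk R _ _ _ hn he) mS.
  rewrite -[in RHS](ay_binf hn he) (push (gen e lb) binf _ mS').
  by congr (rho binf _); apply/seteqP; split=> x /=; rewrite ak_gen.
have mpA := preimage_measurable (@measurable_xplus R _ _ _ hn he binf) mA.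
rewrite rimE -kaph // kapE.
pose F : set (borel Xs) := [set x | xy x = binf].
have F0 : rho binf (~` F) = 0%E := rim_off_fiber binf.
have mF : measurable (~` F) by apply: open_measurable_cspace; exact: fiberC_open.
have half S S' : measurable S -> measurable S' -> S `<=` S' `|` ~` F ->
    (rho binf S <= rho binf S')%E.
  move=> mS mS' SS'.
  have h1 : (rho binf S <= rho binf (S' `|` ~` F))%E.
    by apply: le_measure; rewrite ?inE //; exact: measurableU.
  apply: (le_trans h1); apply: (le_trans (measureU2 _ mS' mF)).
  by rewrite [X in (_ + X)%E]F0 adde0.
have mA' : measurable (xk @^-1` (xplus binf @^-1` A) : set (borel Xs)).
  exact: preimage_measurable (@measurable_xk R _ _ _ hn he) mpA.
apply/eqP; rewrite eq_le; apply/andP; split; apply: half => // x Hx.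
  have [Fx|nFx] := pselect (F x); last by right.
  by left; rewrite /preimage /= -binf_fiber.
have [Fx|nFx] := pselect (F x); last by right.
by left; rewrite (binf_fiber Fx).
Qed.

Lemma cyl_indic_continuous (l : seq (xidx n * bool)) :
  continuous (\1_(cyl (@xcoord _ _ e hn he) l) : Xs -> R).
Proof.
move=> x; apply/(@cvgrPdist_lt _ _ _ _ (nbhs_filter (x : Xs))) => eps e0.
suff H : \forall z \near (x : Xs), cyl (@xcoord _ _ e hn he) l z <-> cyl (@xcoord _ _ e hn he) l x.
  apply: filterS H => z H; rewrite !indicE.
  have -> : (z \in cyl (@xcoord _ _ e hn he) l) = (x \in cyl (@xcoord _ _ e hn he) l).
    by apply/idP/idP; rewrite !inE => /H.
  by rewrite subrr normr0.
elim: l => [|[i b] l IH]; first by apply: filterS filterT.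
apply: filterS (filterI IH (@xcoord_near R _ _ _ hn he i x)) => z [h1 h2].
by rewrite /cyl /= h2; split=> /andP[-> h] /=; apply/h1.
Qed.

Lemma mint_indic (mu : prob R Xs) (A : set (borel Xs)) : measurable A ->
  mint mu (\1_A) = fine (mu A).
Proof. by move=> mA; rewrite /mint /Rintegral integral_indic // setIT. Qed.

(** Equivariance carries the equality over b^oo to its orbit, which is dense; cylinders are clopen,
    so their mass is continuous in [y] for both families. *)
Lemma rim_unique y (A : set (borel Xs)) : measurable A -> rho y A = rim y A.
Proof.
move: A; apply: prob_eq_cyl => l.
pose C : set (borel Xs) := cyl (@xcoord _ _ e hn he) l.
have mC : measurable C by exact: cyl_measurable.
have [c1 push1 _] := rhoP; have [c2 push2 _] := rim_is_RIM R hn he.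
have orb g : rho (ay g binf) C = rim (ay g binf) C.
  rewrite (push1 g binf C mC) (push2 g binf C mC); apply: rim_at_binf.
  exact: preimage_measurable (@measurable_xact R _ _ _ hn he g) mC.
have fn (mu : prob R Xs) : mu C \is a fin_num by exact: fin_num_measure.
rewrite -/C -(fineK (fn _)) -[RHS](fineK (fn _)) -!mint_indic //; congr EFin.
apply/eqP; rewrite -subr_eq0; apply/eqP/normr0_eq0/eqP.
rewrite eq_le normr_ge0 andbT; apply/ler_addgt0Pl => eps e0; rewrite addr0.
have e20 : 0 < eps / 2 by rewrite divr_gt0.
have FY := nbhs_filter (y : Ys).
have n1 := (@cvgrPdist_lt _ _ _ _ FY _ _).1 (c1 _ (@cyl_indic_continuous l) y) _ e20.
have n2 := (@cvgrPdist_lt _ _ _ _ FY _ _).1 (c2 _ (@cyl_indic_continuous l) y) _ e20.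
have [N HN] := filterI n1 n2; have [M HM] := yagree_agree n N.
have [g [gy _]] := orbit_dense he hn binf k0 y k0 M.
have [h1 h2] : _ /\ _ := HN (ay g binf) (HM _ _ (fun i im => esym (gy i im))).
have E : mint (rho (ay g binf)) (\1_C) = mint (rim (ay g binf)) (\1_C).
  by rewrite !mint_indic // orb.
have := ler_distD (mint (rim (ay g binf)) \1_C) (mint (rho y) \1_C) (mint (rim y) \1_C).
rewrite -{1}E => h3; move: h1 h2; rewrite -/C => h1 h2.
apply: (le_trans h3); rewrite [leRHS]splitr; apply: ltW; apply: ltrD => //.
by rewrite distrC.
Qed.

End Unique.

Lemma xy_unique_RIM :
  unique_RIM R (xact : G -> Xs -> Xs) (ay : G -> Ys -> Ys) (xy : Xs -> Ys).
Proof.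
exists rim; split; first exact: rim_is_RIM.
by move=> rho rhoP y A mA; exact: rim_unique.
Qed.

End UniqueRIM.

Theorem theorem1p2 (R : realType) (G : group) (n : nat) (e : 'I_n -> G) :
  (2 <= n)%N -> free_basis e ->
  exists (X Y : pseudoPMetricType R) (aX : G -> X -> X) (aY : G -> Y -> Y)
         (pi : X -> Y),
    [/\ cm_space X, cm_space Y, is_action aX, is_action aY &
    [/\ minimal_action aX, null_action R aX,
        effective_action aY, strongly_proximal R aY &
    [/\ factor_map aX aY pi, point_distal aX pi, ~ open_map pi &
        unique_RIM R aX aY pi]]].
Proof.
move=> hn he.
exists (Xs R hn he), (Ys R hn), (@xact _ _ _ hn he), (ay he), (@xy _ _ _ hn he).
split; [..|split; [..|split]].
- by split; [exact: Xs_hausdorff|exact: Xs_compact].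
- by split; [exact: Ys_hausdorff|exact: Ys_compact].
- by split; [exact: xact_continuous|exact: xact1|exact: xactM].
- by split; [exact: ay_continuous|exact: ay1|exact: ayM].
- exact: xact_minimal.
- exact: xact_null.
- exact: (@ay_effective _ _ _ he hn).
- exact: ay_strongly_proximal.
- by split=> // [|y]; [exact: xy_continuous|exists (xplus hn he y k0)].
- exact: xy_point_distal.
- exact: xy_not_open.
- exact: xy_unique_RIM.
Qed.
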